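(* Fix $l\in\mathbb{N}$. For a tensor product $\otimes_\alpha$ of order $l$ of $0$-symmetric convex bodies, let $\|\cdot\|_{\otimes_\alpha}$ be the tensor norm of order $l$ on finite dimensional real Banach spaces given, for finite dimensional Banach spaces $M_1,\ldots,M_l$ with closed unit balls $B_1,\ldots,B_l$, by $\|z\|_{\otimes_\alpha}:=g_{B_1\otimes_\alpha\cdots\otimes_\alpha B_l}(z)$, $z\in\otimes_{i=1}^l M_i$. Then the mapping $$\Psi:\{\text{tensor products of order } l \text{ of } 0\text{-symmetric convex bodies}\}\longrightarrow\{\text{tensor norms of order } l\text{ on finite dimensional Banach spaces}\},\qquad \otimes_\alpha\mapsto\|\cdot\|_{\otimes_\alpha},$$ is a bijection. Moreover, for tensor products $\otimes_\alpha,\otimes_\beta$ of order $l$ of $0$-symmetric convex bodies: (i) $\otimes_\beta$ is the dual tensor product of $\otimes_\alpha$ if and only if $\|\cdot\|_{\otimes_\beta}$ is the dual tensor norm of $\|\cdot\|_{\otimes_\alpha}$; (ii) $\otimes_\alpha$ is injective (respectively, projective) if and only if $\|\cdot\|_{\otimes_\alpha}$ is injective (respectively, projective).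
   Context: All vector spaces are real. A Euclidean space is a finite dimensional real inner product space; $\mathbb{E}_i,\mathbb{F}_i$ denote Euclidean spaces. $\otimes_{i=1}^l\mathbb{E}_i$ carries the scalar product determined by $\langle x^1\otimes\cdots\otimes x^l,y^1\otimes\cdots\otimes y^l\rangle_H=\prod_i\langle x^i,y^i\rangle_{\mathbb{E}_i}$. A convex body is a compact convex set with nonempty interior; it is $0$-symmetric if $P=-P$. The polar of $C$ is $C^\circ=\{y:\sup_{x\in C}\langle x,y\rangle\le1\}$ (with respect to $\langle\cdot,\cdot\rangle_H$ in tensor product spaces). The Minkowski functional is $g_P(x)=\inf\{\lambda>0:\lambda^{-1}x\in P\}$. For convex bodies $P_i\subset\mathbb{E}_i$ with $0$ in the interior, $P_1\otimes_\pi\cdots\otimes_\pi P_l:=\mathrm{conv}\{x^1\otimes\cdots\otimes x^l:x^i\in P_i\}$ and $P_1\otimes_\epsilon\cdots\otimes_\epsilon P_l:=(P_1^\circ\otimes_\pi\cdots\otimes_\pi P_l^\circ)^\circ$. A tensor product $\otimes_\alpha$ of order $l$ of $0$-symmetric convex bodies assigns to each $l$-tuple of $0$-symmetric convex bodies $P_i\subset\mathbb{E}_i$ (in arbitrary Euclidean spaces) a $0$-symmetric convex body $P_1\otimes_\alpha\cdots\otimes_\alpha P_l\subset\otimes_{i=1}^l\mathbb{E}_i$ such that (1) $P_1\otimes_\pi\cdots\otimes_\pi P_l\subseteq P_1\otimes_\alpha\cdots\otimes_\alpha P_l\subseteq P_1\otimes_\epsilon\cdots\otimes_\epsilon P_l$;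 (2) (uniform property) for all linear $T_i:\mathbb{E}_i\to\mathbb{F}_i$ and $0$-symmetric convex bodies $Q_i\subset\mathbb{F}_i$ with $T_i(P_i)\subseteq Q_i$, $T_1\otimes\cdots\otimes T_l(P_1\otimes_\alpha\cdots\otimes_\alpha P_l)\subseteq Q_1\otimes_\alpha\cdots\otimes_\alpha Q_l$. Its dual $\otimes_{\alpha'}$ is $P_1\otimes_{\alpha'}\cdots\otimes_{\alpha'}P_l:=(P_1^\circ\otimes_\alpha\cdots\otimes_\alpha P_l^\circ)^\circ$. It is injective if $(P_1\cap M_1)\otimes_\alpha\cdots\otimes_\alpha(P_l\cap M_l)=(P_1\otimes_\alpha\cdots\otimes_\alpha P_l)\cap\otimes_{i=1}^l M_i$ for all $0$-symmetric convex bodies $P_i\subset\mathbb{E}_i$ and all subspaces $M_i\subseteq\mathbb{E}_i$ (with the induced scalar product). It is projective if $T_1\otimes\cdots\otimes T_l(P_1\otimes_\alpha\cdots\otimes_\alpha P_l)=T_1P_1\otimes_\alpha\cdots\otimes_\alpha T_lP_l$ for all $0$-symmetric convex bodies $P_i\subset\mathbb{E}_i$ and all surjective linear $T_i:\mathbb{E}_i\to\mathbb{F}_i$. For finite dimensional Banach spaces $M_i$, the body $B_1\otimes_\alpha\cdots\otimes_\alpha B_l$ is formed after fixing an arbitrary scalar product on each $M_i$; the result does not depend on the choice. A tensor norm $\alpha$ of order $l$ on finite dimensional Banach spaces assigns to each $l$-tuple $M_1,\ldots,M_l$ of finite dimensional Banach spaces a norm $\alpha$ on $\otimes_{i=1}^l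 M_i$ such that (1) it is a reasonable crossnorm: $\epsilon(u)\le\alpha(u)\le\pi(u)$, where $\pi(u)=\inf\{\sum_j\|x_j^1\|\cdots\|x_j^l\|:u=\sum_j x_j^1\otimes\cdots\otimes x_j^l\}$ and $\epsilon(u)=\sup\{|x_1^*\otimes\cdots\otimes x_l^*(u)|:x_i^*\in B_{M_i^*}\}$; (2) $\|T_1\otimes\cdots\otimes T_l:(\otimes M_i,\alpha)\to(\otimes N_i,\alpha)\|\le\|T_1\|\cdots\|T_l\|$ for all linear $T_i:M_i\to N_i$. The dual tensor norm is $\alpha'_{M_1,\ldots,M_l}(u)=\sup\{|\varphi(u)|:\varphi\in\otimes_i M_i^*,\ \alpha_{M_1^*,\ldots,M_l^*}(\varphi)\le1\}$. $\alpha$ is injective if for all subspaces $E_i\subseteq X_i$ the natural map $(\otimes E_i,\alpha)\to(\otimes X_i,\alpha)$ is isometric; $\alpha$ is projective if $S_1\otimes\cdots\otimes S_l:(\otimes X_i,\alpha)\to(\otimes Y_i,\alpha)$ is a quotient operator whenever all $S_i:X_i\to Y_i$ are quotient operators (all spaces finite dimensional; a quotient operator is a linear map sending the open unit ball onto the open unit ball). *)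

(* Defs.v *)
From HB Require Import structures.
From mathcomp Require Import all_boot all_order all_algebra.
From mathcomp Require Import boolp classical_sets functions reals ereal.
From mathcomp Require Import topology normedtype convex derive.
From mathcomp Require Import ring lra.
Import numFieldNormedType.Exports.
Import Order.TTheory GRing.Theory Num.Theory.
Set Implicit Arguments.
Unset Strict Implicit.
Unset Printing Implicit Defensive.
Local Open Scope classical_set_scope.
Local Open Scope ring_scope.

Definition stdbasis (R : fieldType) (V : vectType R) (k : 'I_(\dim {:V})) : V :=
  (vbasis {:V})`_k.

Definition stdcoord (R : fieldType) (V : vectType R) (k : 'I_(\dim {:V})) (x : V) : R :=
  coord (vbasis {:V}) k x.

(* The tensor product of V_1, ..., V_l is modelled by arrays of coordinates in the
   products of the library bases [vbasis] of the factors. [tlift_tprod] and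
   [eq_linear_tensor] below are its universal property: a multilinear map f
   factors through [tprod] by the linear map [tlift f], and a linear map is
   determined by its values on the elementary tensors [tprod x]. *)
Definition tensor_index (R : fieldType) l (V : 'I_l -> vectType R) : finType :=
  {dffun forall i : 'I_l, 'I_(\dim {:V i})}.

Definition tensor (R : fieldType) l (V : 'I_l -> vectType R) : vectType R :=
  {ffun tensor_index V -> R^o}.

Section Tensor.
Variables (R : fieldType) (l : nat).
Implicit Types V W : 'I_l -> vectType R.

Definition tprod V (x : forall i, V i) : tensor V :=
  [ffun j : tensor_index V => \prod_i stdcoord (j i) (x i)].

Definition multilinear V (U : lmodType R) (f : (forall i, V i) -> U) :=
  forall (x : forall i, V i) (i : 'I_l) a (y z : V i),
    f (@dfwith _ V x i (a *: y + z)) =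
      a *: f (@dfwith _ V x i y) + f (@dfwith _ V x i z).

Definition tlift V (U : lmodType R) (f : (forall i, V i) -> U) (u : tensor V) : U :=
  \sum_(j : tensor_index V) u j *: f (fun i => stdbasis (j i)).

Fact tlift_is_linear V (U : lmodType R) f : linear (@tlift V U f).
Proof.
move=> a u v; rewrite /tlift scaler_sumr -big_split; apply: eq_bigr => j _ /=.
by rewrite !ffunE scalerDl scalerA.
Qed.
HB.instance Definition _ V (U : lmodType R) f :=
  GRing.isLinear.Build R (tensor V) U *:%R (@tlift V U f) (@tlift_is_linear V U f).

Lemma stdcoordK (V : vectType R) (x : V) : x = \sum_k stdcoord k x *: stdbasis k.
Proof. exact: coord_vbasis (memvf x). Qed.

Lemma stdcoord_basis (V : vectType R) (j k : 'I_(\dim {:V})) :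
  stdcoord j (stdbasis k) = (j == k)%:R.
Proof. by rewrite /stdcoord /stdbasis coord_free ?(basis_free (vbasisP _)) // eq_sym. Qed.

Lemma stdcoordP (V : vectType R) (k : 'I_(\dim {:V})) a x y :
  stdcoord k (a *: x + y) = a * stdcoord k x + stdcoord k y.
Proof. exact: linearP. Qed.

Lemma tprod_basis V (j j' : tensor_index V) :
  tprod (fun i => stdbasis (j i)) j' = (j' == j)%:R.
Proof.
rewrite ffunE; have [->|jj'] := eqVneq j' j.
  by apply: big1 => i _; rewrite stdcoord_basis eqxx.
have [i ji] : exists i, j' i != j i.
  apply/existsP; apply: contraNT jj'; rewrite negb_exists => /forallP jj'.
  by apply/eqP/ffunP => i; apply/eqP; have := jj' i; rewrite negbK.
by rewrite (bigD1 i) //= stdcoord_basis (negbTE ji) mul0r.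
Qed.

Lemma tlift_basis V (U : lmodType R) (f : (forall i, V i) -> U) (j : tensor_index V) :
  tlift f (tprod (fun i => stdbasis (j i))) = f (fun i => stdbasis (j i)).
Proof.
rewrite /tlift (bigD1 j) //= tprod_basis eqxx scale1r big1 ?addr0 // => k kj.
by rewrite tprod_basis (negbTE kj) scale0r.
Qed.

Lemma tensorE V (u : tensor V) :
  u = \sum_(j : tensor_index V) u j *: tprod (fun i => stdbasis (j i)).
Proof.
apply/ffunP => k; rewrite sum_ffunE (bigD1 k) //= ffunE tprod_basis eqxx.
rewrite big1 => [|j jk]; first by rewrite addr0 /GRing.scale /= mulr1.
by rewrite ffunE tprod_basis eq_sym (negbTE jk) scaler0.
Qed.

Lemma tprod_multilinear V : multilinear (@tprod V).
Proof.
move=> x i a y z; apply/ffunP => j; rewrite !ffunE.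
rewrite !(bigD1 (P := xpredT) i) //= !dfwith_in stdcoordP mulrDl.
rewrite /GRing.scale /= mulrA.
by congr (_ * _ + _ * _); apply: eq_bigr => k ki; rewrite !dfwith_out 1?eq_sym.
Qed.

Lemma multilinear_sum V (U : lmodType R) (f : (forall i, V i) -> U) :
  multilinear f -> forall x i (I : finType) (a : I -> R) (y : I -> V i),
  f (@dfwith _ V x i (\sum_k a k *: y k)) = \sum_k a k *: f (@dfwith _ V x i (y k)).
Proof.
move=> mf x i I a y.
have f0 : f (@dfwith _ V x i 0) = 0.
  have := mf x i (-1) 0 0; rewrite scaler0 addr0 => ->.
  by rewrite scaleN1r addNr.
apply: (big_rec2 (fun z t => f (@dfwith _ V x i z) = t)) => // k t z _ <-.
exact: mf.
Qed.

Lemma eq_multilinear V (U : lmodType R) (f g : (forall i, V i) -> U) :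
  multilinear f -> multilinear g ->
  (forall j : tensor_index V,
     f (fun i => stdbasis (j i)) = g (fun i => stdbasis (j i))) -> f =1 g.
Proof.
move=> mf mg fg.
suff H n : forall x, (forall i : 'I_l, (n <= i)%N -> exists k, x i = stdbasis k) ->
    f x = g x.
  by move=> x; apply: (H l) => i; rewrite leqNgt ltn_ord.
elim: n => [|n IHn] x xb.
  pose j' : tensor_index V := [ffun i => projT1 (cid (xb i (leq0n _)))].
  have -> : x = (fun i => stdbasis (j' i)).
    by apply: functional_extensionality_dep => i; rewrite ffunE; case: cid.
  exact: fg.
have [nl|ln] := ltnP n l; last first.
  by apply: IHn => i ni; by rewrite leqNgt (leq_trans (ltn_ord i) ln) in ni.
pose i0 := Ordinal nl.
have -> : x = @dfwith _ V x i0 (\sum_k stdcoord k (x i0) *: stdbasis k).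
  apply: functional_extensionality_dep => i; rewrite -stdcoordK.
  by case: dfwithP.
rewrite !multilinear_sum //; apply: eq_bigr => k _; congr (_ *: _).
apply: IHn => i ni; have [->|ii0] := eqVneq i i0.
  by exists k; rewrite dfwith_in.
rewrite dfwith_out 1?eq_sym //; apply: xb.
by rewrite ltn_neqAle ni andbT eq_sym; apply: contra ii0 => /eqP ii0; apply/eqP/val_inj.
Qed.

Lemma multilinear_linear V (U U' : lmodType R) (f : (forall i, V i) -> U)
    (g : {linear U -> U'}) : multilinear f -> multilinear (fun x => g (f x)).
Proof. by move=> mf x i a y z; rewrite mf linearP. Qed.

Lemma tlift_tprod V (U : lmodType R) (f : (forall i, V i) -> U) x :
  multilinear f -> tlift f (tprod x) = f x.
Proof.
move=> mf; apply: (eq_multilinear (f := fun x => tlift f (tprod x))) => //.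
  exact: multilinear_linear (@tprod_multilinear V).
by move=> j; rewrite tlift_basis.
Qed.

Lemma eq_linear_tensor V (U : lmodType R) (f g : {linear tensor V -> U}) :
  (forall x, f (tprod x) = g (tprod x)) -> f =1 g.
Proof.
move=> fg u; rewrite (tensorE u) !linear_sum; apply: eq_bigr => j _.
by rewrite !linearZ fg.
Qed.
End Tensor.

Section Dot.
Variables (R : realType) (V : vectType R) (f : V -> V -> R).
Hypothesis fC : forall x y, f x y = f y x.
Hypothesis fP : forall a x y z, f (a *: x + y) z = a * f x z + f y z.
Hypothesis f_gt0 : forall x, x != 0 -> 0 < f x x.

Fact mk_dot_bilinear : bilinear_for *%R ((idfun : R -> R) \; *%R) f.
Proof.
by split=> [y|x] a u v /=; [|rewrite !(fC x)]; rewrite fP.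
Qed.

Fact mk_dot_herm x y : f x y = (-1) ^+ false * idfun (f y x).
Proof. by rewrite expr0 mul1r fC. Qed.

Definition mk_dot : {dot V for idfun} :=
  HB.pack_for {dot V for idfun} f
    (bilinear_isBilinear.Build R V V R *%R ((idfun : R -> R) \; *%R) f mk_dot_bilinear)
    (isHermitianSesquilinear.Build R V false idfun f mk_dot_herm)
    (isDotProduct.Build R V f f_gt0).
Lemma mk_dotE x y : mk_dot x y = f x y. Proof. by []. Qed.
End Dot.

Section DotTheory.
Variables (R : realType) (V : vectType R) (s : {dot V for idfun}).

Lemma dotC x y : s x y = s y x.
Proof. by have := @hermitian_subproof _ _ _ _ s x y; rewrite expr0 mul1r. Qed.

Lemma dotP a x y z : s (a *: x + y) z = a * s x z + s y z.
Proof. exact: linearPl. Qed.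

Lemma dotDl x y z : s (x + y) z = s x z + s y z.
Proof. exact: linearDl. Qed.

Lemma dotDr x y z : s z (x + y) = s z x + s z y.
Proof. by rewrite !(dotC z) dotDl. Qed.

Lemma dotZl a x z : s (a *: x) z = a * s x z.
Proof. exact: linearZl_LR. Qed.

Lemma dotZr a x z : s z (a *: x) = a * s z x.
Proof. by rewrite !(dotC z) dotZl. Qed.

Lemma dot0l z : s 0 z = 0.
Proof. by rewrite -(scale0r 0) dotZl mul0r. Qed.

Lemma dot_suml (I : finType) (F : I -> V) z : s (\sum_i F i) z = \sum_i s (F i) z.
Proof. exact: (big_morph (s^~ z) (fun x y => dotDl x y z) (dot0l z)). Qed.

Lemma dot_sumr (I : finType) (F : I -> V) z : s z (\sum_i F i) = \sum_i s z (F i).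
Proof. by rewrite dotC dot_suml; apply: eq_bigr => i _; rewrite dotC. Qed.

Lemma dot_gt0 x : x != 0 -> 0 < s x x.
Proof. exact: neq0_dnorm_gt0. Qed.

Lemma dot_ge0 x : 0 <= s x x.
Proof. by have [->|/dot_gt0/ltW//] := eqVneq x 0; rewrite dot0l. Qed.

Lemma dot_eq0 x : s x x = 0 -> x = 0.
Proof. by move=> sx; apply/eqP; apply: contra_eqT sx => /dot_gt0; rewrite lt0r => /andP[]. Qed.

Definition dnorm x := Num.sqrt (s x x).

Lemma dnorm_ge0 x : 0 <= dnorm x. Proof. exact: sqrtr_ge0. Qed.

Lemma dnorm_sqr x : dnorm x ^+ 2 = s x x.
Proof. by rewrite sqr_sqrtr // dot_ge0. Qed.

Lemma dnorm_eq0 x : dnorm x = 0 -> x = 0.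
Proof. by move=> x0; apply: dot_eq0; rewrite -dnorm_sqr x0 expr0n. Qed.

Lemma dnormZ a x : dnorm (a *: x) = `|a| * dnorm x.
Proof. by rewrite /dnorm dotZl dotZr mulrA sqrtrM ?sqr_ge0 // sqrtr_sqr. Qed.

Lemma dot_CauchySchwarz x y : `|s x y| <= dnorm x * dnorm y.
Proof.
rewrite -(@ler_sqr _ _ _) ?nnegrE ?mulr_ge0 ?dnorm_ge0 // real_normK ?num_real //.
rewrite exprMn !dnorm_sqr.
have [->|y0] := eqVneq y 0; first by rewrite dotC !dot0l expr0n mulr0.
have yy := dot_gt0 y0.
have := dot_ge0 (s y y *: x + - s x y *: y).
rewrite !dotDl !dotDr !dotZl !dotZr (dotC y x).
set a := s x x; set b := s x y; set c := s y y => H.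
have : 0 <= c * (a * c - b ^+ 2) by lra.
by rewrite pmulr_rge0 // subr_ge0.
Qed.

Lemma dnormD x y : dnorm (x + y) <= dnorm x + dnorm y.
Proof.
rewrite -(@ler_sqr _ _ _) ?nnegrE ?addr_ge0 ?dnorm_ge0 // sqrrD !dnorm_sqr.
rewrite !dotDl !dotDr (dotC y x).
have := le_trans (ler_norm _) (dot_CauchySchwarz x y); lra.
Qed.

Definition orthonormal n (e : 'I_n -> V) := forall i j, s (e i) (e j) = (i == j)%:R.

Lemma ex_orthonormal_basis :
  exists e : 'I_(\dim {:V}) -> V,
    orthonormal e /\ forall x, x = \sum_k s x (e k) *: e k.
Proof.
suff H (X : seq V) : exists Y : seq V,
    [/\ forall i j, (i < size Y)%N -> (j < size Y)%N -> s Y`_i Y`_j = (i == j)%:R,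
      <<Y>>%VS = <<X>>%VS & uniq Y].
  have [Y [oY spY _]] := H (vbasis {:V}).
  have exY x : x = \sum_(k < size Y) s x Y`_k *: Y`_k.
    have : x \in <<in_tuple Y>>%VS.
      by rewrite /= spY (span_basis (vbasisP _)) memvf.
    move=> /coord_span xY; rewrite [LHS]xY; apply: eq_bigr => k _; congr (_ *: _).
    rewrite [in RHS]xY dot_suml (bigD1 k) //= dotZl oY // eqxx mulr1 big1 ?addr0 // => j jk.
    by rewrite dotZl oY // (inj_eq val_inj) (negbTE jk) mulr0.
  have fY : free (in_tuple Y).
    apply/freeP => a a0 i.
    have : s (\sum_(i < size Y) a i *: Y`_i) Y`_i = 0 by rewrite a0 dot0l.
    rewrite dot_suml (bigD1 i) //= dotZl oY // eqxx mulr1 big1 ?addr0 // => j jk.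
    by rewrite dotZl oY // (inj_eq val_inj) (negbTE jk) mulr0.
  have sY : size Y = \dim {:V}.
    move: fY; rewrite /free => /eqP <-.
    by rewrite spY (span_basis (vbasisP _)).
  rewrite -sY; exists (fun k => Y`_k); split=> // i j.
  by rewrite oY // (inj_eq val_inj).
elim: X => [|x X [Y [oY spY uY]]]; first by exists [::].
pose p := \sum_(k < size Y) s x Y`_k *: Y`_k.
have pY : p \in <<Y>>%VS.
  by apply: memv_suml => k _; apply/memvZ/memv_span/mem_nth.
have rY k : (k < size Y)%N -> s (x - p) Y`_k = 0.
  move=> kY; rewrite dotDl -scaleN1r dotZl dot_suml (bigD1 (Ordinal kY)) //=.
  rewrite [s (_ *: Y`_k) _]dotZl oY // eqxx mulr1 big1 ?addr0 ?mulN1r ?subrr // => j jk.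
  rewrite dotZl oY // (_ : _ == _ = false) ?mulr0 //.
  by apply: contraNF jk => /eqP jk; apply/eqP/val_inj.
have [r0|r0] := eqVneq (x - p) 0.
  exists Y; split=> //; rewrite span_cons -spY; apply/esym/addv_idPr.
  by rewrite -memvE; move/eqP: r0; rewrite subr_eq0 => /eqP ->.
pose y := (dnorm (x - p))^-1 *: (x - p).
have dr : 0 < dnorm (x - p) by rewrite sqrtr_gt0 dot_gt0.
have yy : s y y = 1.
  by rewrite dotZl dotZr -dnorm_sqr; field; rewrite gt_eqF.
have yY k : (k < size Y)%N -> s y Y`_k = 0.
  by move=> kY; rewrite dotZl rY // mulr0.
exists (y :: Y); split.
- case=> [|i] [|j] //= iY jY; first by rewrite yY.
  + by rewrite dotC yY.
  + by rewrite oY.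
- rewrite !span_cons -spY; apply/eqP; rewrite eqEsubv !subv_add !addvSr !andbT.
  rewrite -!memvE; apply/andP; split.
    by apply: memvZ; rewrite memv_add ?memvN // memv_line.
  have xE : x = dnorm (x - p) *: y + p.
    by rewrite scalerA divff ?gt_eqF // scale1r subrK.
  by rewrite [X in X \in _]xE; apply: memv_add; [exact/memvZ/memv_line|].
- rewrite cons_uniq uY andbT; apply/negP => /(nthP 0)[k kY yk].
  by have := yY k kY; rewrite yk yy => /eqP; rewrite oner_eq0.
Qed.
End DotTheory.

Section TensorDot.
Variables (R : realType) (l : nat).
Implicit Types V : 'I_l -> vectType R.

Lemma multilinear_expand V (U : lmodType R) (f : (forall i, V i) -> U)
    (a : forall i, 'I_(\dim {:V i}) -> R) (y : forall i, 'I_(\dim {:V i}) -> V i) :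
  multilinear f ->
  f (fun i => \sum_m a i m *: y i m) =
  \sum_(k : tensor_index V) (\prod_i a i (k i)) *: f (fun i => y i (k i)).
Proof.
move=> mf.
pose L i (x : V i) : V i := \sum_m stdcoord m x *: y i m.
have LP i b u v : L i (b *: u + v) = b *: L i u + L i v.
  rewrite /L scaler_sumr -big_split; apply: eq_bigr => m _ /=.
  by rewrite stdcoordP scalerDl scalerA.
have Lb i m : L i (stdbasis m) = y i m.
  rewrite /L (bigD1 m) //= stdcoord_basis eqxx scale1r big1 ?addr0 // => j jm.
  by rewrite stdcoord_basis (negbTE jm) scale0r.
have Ldf x i z : (fun j => L j (@dfwith _ V x i z j)) =
    @dfwith _ V (fun j => L j (x j)) i (L i z).
  apply: functional_extensionality_dep => j.
  by have [->|ij] := eqVneq j i; rewrite ?dfwith_in // !dfwith_out 1?eq_sym.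
have mfL : multilinear (fun x => f (fun i => L i (x i))).
  by move=> x i b u v; rewrite !Ldf LP mf.
pose x i : V i := \sum_m a i m *: stdbasis m.
have cx i m : stdcoord m (x i) = a i m.
  have sb := @stdcoord_basis _ (V i); rewrite /stdcoord in sb *.
  rewrite linear_sum (bigD1 m) //= linearZ /= sb.
  rewrite eqxx big1 => [|j jm]; first by rewrite addr0 /= mulr1.
  by rewrite linearZ /= sb eq_sym (negbTE jm) /= mulr0.
have := tlift_tprod x mfL; rewrite /tlift => H; apply: etrans (etrans (esym H) _).
  by congr f; apply: functional_extensionality_dep => i; apply: eq_bigr => m _; rewrite cx.
apply: eq_bigr => k _; rewrite ffunE; congr (_ *: _).
  by apply: eq_bigr => i _; rewrite cx.
by congr f; apply: functional_extensionality_dep => i; rewrite Lb.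
Qed.

Lemma multilinear_prod V (g : forall i, V i -> R) :
  (forall i a x y, g i (a *: x + y) = a * g i x + g i y) ->
  multilinear (fun x : forall i, V i => \prod_i g i (x i) : R^o).
Proof.
move=> gP x i a y z; rewrite !(bigD1 (P := xpredT) i) //= !dfwith_in gP mulrDl.
rewrite /GRing.scale /= mulrA.
by congr (_ * _ + _ * _); apply: eq_bigr => k ki; rewrite !dfwith_out 1?eq_sym.
Qed.

Variables (V : 'I_l -> vectType R) (s : forall i, {dot (V i) for idfun}).

Definition tensor_dot_fun (u v : tensor V) : R :=
  tlift (fun x => tlift (fun y => \prod_i s i (x i) (y i) : R^o) v : R^o) u.

Lemma tensor_dot_funE u v : tensor_dot_fun u v =
  \sum_(j : tensor_index V) \sum_(k : tensor_index V)
     u j * v k * \prod_i s i (stdbasis (j i)) (stdbasis (k i)).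
Proof.
apply: eq_bigr => j _; rewrite scaler_sumr; apply: eq_bigr => k _.
by rewrite /GRing.scale /= mulrA.
Qed.

Lemma tensor_dot_funC u v : tensor_dot_fun u v = tensor_dot_fun v u.
Proof.
rewrite !tensor_dot_funE exchange_big; apply: eq_bigr => j _; apply: eq_bigr => k _ /=.
by rewrite [u k * _]mulrC; congr (_ * _); apply: eq_bigr => i _; rewrite dotC.
Qed.

Lemma tensor_dot_funP a u v w :
  tensor_dot_fun (a *: u + v) w = a * tensor_dot_fun u w + tensor_dot_fun v w.
Proof. exact: linearP. Qed.

Lemma tensor_dot_fun_gt0 u : u != 0 -> 0 < tensor_dot_fun u u.
Proof.
pose e i := projT1 (cid (ex_orthonormal_basis (s i))).
have eP i : orthonormal (s i) (e i) /\ forall x, x = \sum_k s i x (e i k) *: e i k.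
  by rewrite /e; case: cid.
pose c (k : tensor_index V) (x : tensor V) : R^o :=
  tlift (fun x => \prod_i s i (x i) (e i (k i)) : R^o) x.
have msl (y : forall i, V i) : multilinear (fun x : forall i, V i => \prod_i s i (x i) (y i) : R^o).
  by apply: (multilinear_prod (g := fun i x => s i x (y i))) => i a x z; exact: dotP.
have ck k x : c k (tprod x) = \prod_i s i (x i) (e i (k i)) by apply: tlift_tprod.
have exp_e (x : forall i, V i) : x = (fun i => \sum_m s i (x i) (e i m) *: e i m).
  by apply: functional_extensionality_dep => i; exact: (eP i).2.
have uc (x : tensor V) : x = \sum_k c k x *: tprod (fun i => e i (k i)).
  rewrite [LHS]tensorE; under [RHS]eq_bigr do rewrite /c scaler_suml.
  rewrite exchange_big; apply: eq_bigr => j _ /=.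
  rewrite [in LHS](exp_e (fun i => stdbasis (j i))) multilinear_expand; last exact: tprod_multilinear.
  by rewrite scaler_sumr; apply: eq_bigr => k _; rewrite !scalerA.
have dc x y : tensor_dot_fun x y = \sum_k c k x * c k y.
  rewrite tensor_dot_funE.
  under [RHS]eq_bigr do rewrite /c /tlift mulr_suml.
  rewrite [RHS]exchange_big; apply: eq_bigr => j _ /=.
  under [RHS]eq_bigr do rewrite mulr_sumr.
  rewrite [RHS]exchange_big; apply: eq_bigr => k _ /=.
  have -> : \prod_i s i (stdbasis (j i)) (stdbasis (k i)) =
     \sum_(m : tensor_index V) (\prod_i s i (stdbasis (j i)) (e i (m i))) *
        (\prod_i s i (stdbasis (k i)) (e i (m i))).
    rewrite -/((fun x : forall i, V i => \prod_i s i (x i) (stdbasis (k i)) : R^o)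
      (fun i => stdbasis (j i))).
    rewrite [in LHS](exp_e (fun i => stdbasis (j i))).
    rewrite (multilinear_expand _ _ (msl (fun i => stdbasis (k i)))).
    apply: eq_bigr => m _; congr (_ * _); apply: eq_bigr => i _; exact: dotC.
  by rewrite mulr_sumr; apply: eq_bigr => m _; rewrite /GRing.scale /=; ring.
move=> u0; rewrite lt0r dc; apply/andP; split; last first.
  by apply: sumr_ge0 => k _; rewrite -expr2 sqr_ge0.
apply: contraNneq u0 => /eqP.
rewrite psumr_eq0 => [/allP cu0|k _]; last by rewrite -expr2 sqr_ge0.
rewrite (uc u) big1 // => k _.
by have := cu0 k (mem_index_enum k); rewrite /= mulf_eq0 orbb => /eqP ->; rewrite scale0r.
Qed.

Definition tensor_dot : {dot (tensor V) for idfun} :=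
  mk_dot tensor_dot_funC tensor_dot_funP tensor_dot_fun_gt0.

Lemma tensor_dot_tprod x y :
  tensor_dot (tprod x) (tprod y) = \prod_i s i (x i) (y i).
Proof.
have mx y' : multilinear (fun x : forall i, V i => \prod_i s i (x i) (y' i) : R^o).
  by apply: (multilinear_prod (g := fun i x => s i x (y' i))) => i a z t; exact: dotP.
rewrite mk_dotE /tensor_dot_fun.
have E (z : forall i, V i) : tlift (fun y => \prod_i s i (z i) (y i) : R^o) (tprod y) =
    \prod_i s i (z i) (y i).
  rewrite tlift_tprod //; apply: (multilinear_prod (g := fun i y => s i (z i) y)) => i a t w.
  by rewrite dotDr dotZr.
by under [X in tlift X]funext do rewrite E; rewrite tlift_tprod.
Qed.
End TensorDot.

Record euclidean (R : realType) := Euclidean {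
  ecarrier :> vectType R;
  edot : {dot ecarrier for idfun} }.

(* [etop E] is E with the norm and the topology induced by its scalar product. It
   is kept apart from E so that the vector space underlying [Euclidean s], for
   s : {dot V for idfun}, is V itself. *)
Definition etop (R : realType) (E : euclidean R) : Type := E.

HB.instance Definition _ (R : realType) (E : euclidean R) :=
  GRing.Lmodule.copy (etop E) (ecarrier E).
HB.instance Definition _ (R : realType) (E : euclidean R) :=
  Lmodule_isNormed.Build R (etop E) (@dnormD R _ (edot E)) (@dnormZ R _ (edot E))
    (@dnorm_eq0 R _ (edot E)).

Lemma etop_normE (R : realType) (E : euclidean R) (x : etop E) :
  `|x| = dnorm (edot E) x.
Proof. by []. Qed.

Definition zero_symmetric (R : realType) (V : vectType R) (P : set V) :=
  P = [set - x | x in P].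

Definition convex_body (R : realType) (E : euclidean R) (P : set E) :=
  [/\ convex_set P, compact (P : set (etop E)) & interior (P : set (etop E)) !=set0].

Record sym_body (R : realType) (E : euclidean R) := SymBody {
  body_set :> set E;
  body_convex : convex_body body_set;
  body_sym : zero_symmetric body_set }.

Definition is_norm (R : realType) (V : vectType R) (N : V -> R) :=
  [/\ forall x y, N (x + y) <= N x + N y,
      forall a x, N (a *: x) = `|a| * N x &
      forall x, N x = 0 -> x = 0].

(* Completeness is automatic in finite dimension. *)
Record banach (R : realType) := Banach {
  bcarrier :> vectType R;
  bnorm : bcarrier -> R;
  bnormP : is_norm bnorm }.

Section Topology.
Variables (R : realType).

Section Seminorm.
Variables (E : euclidean R) (N : E -> R).
Hypothesis ND : forall x y, N (x + y) <= N x + N y.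
Hypothesis NZ : forall a x, N (a *: x) = `|a| * N x.

Lemma seminorm_ge0 x : 0 <= N x.
Proof.
have N0 : N 0 = 0 by rewrite -(scale0r 0) NZ normr0 mul0r.
have := ND x ((-1) *: x); rewrite NZ normrN1 mul1r scaleN1r subrr N0; lra.
Qed.

Lemma seminorm_le : exists2 C, 0 < C & forall x, N x <= C * dnorm (edot E) x.
Proof.
have N0 : N 0 = 0 by rewrite -(scale0r 0) NZ normr0 mul0r.
have [e [oe eE]] := ex_orthonormal_basis (edot E).
have de k : dnorm (edot E) (e k) = 1 by rewrite /dnorm oe eqxx sqrtr1.
have S0 : 0 <= \sum_k N (e k) by apply: sumr_ge0 => k _; exact: seminorm_ge0.
exists (1 + \sum_k N (e k)) => [|x]; first by lra.
rewrite mulrDl mul1r mulr_suml.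
have -> : N x = N (\sum_k edot E x (e k) *: e k) by rewrite -eE.
apply: (@le_trans _ _ (\sum_k N (e k) * dnorm (edot E) x)); last first.
  by rewrite lerDr dnorm_ge0.
elim/big_ind2 : _ => [|y a z b ya zb|k _]; first by rewrite N0.
- by rewrite (le_trans (ND _ _)) // lerD.
- rewrite NZ mulrC ler_wpM2l ?seminorm_ge0 //.
  by rewrite (le_trans (dot_CauchySchwarz _ _ _)) // de mulr1.
Qed.

Lemma seminorm_continuous : continuous (N : etop E -> R).
Proof.
have [C C0 NC] := seminorm_le => x.
apply/(@cvgrPdist_le _ _ _ (nbhs (x : etop E))) => e e0; near=> z.
have sub y t : N y - N t <= N (y - t) by have := ND (y - t) t; rewrite subrK; lra.
have Nsym y t : N (y - t) = N (t - y).
  by rewrite -opprB -scaleN1r NZ normrN1 mul1r.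
have : `|(x : etop E) - z| <= e / C.
  by near: z; apply: cvgr_dist_le; rewrite // divr_gt0.
rewrite etop_normE ler_pdivlMr // => H.
have := NC ((x : E) - z); rewrite mulrC => H2.
have {}H := le_trans H2 H.
rewrite ler_norml; apply/andP; split; last exact: le_trans (sub _ _) H.
by rewrite lerNl opprB (le_trans (sub _ _)) // Nsym.
Unshelve. all: by end_near. Qed.
End Seminorm.

Lemma linear_le (E F : euclidean R) (f : {linear E -> F}) :
  exists2 C, 0 < C & forall x, dnorm (edot F) (f x) <= C * dnorm (edot E) x.
Proof.
apply: (seminorm_le (N := fun x => dnorm (edot F) (f x))) => [x y|a x].
- by rewrite linearD dnormD.
- by rewrite linearZ dnormZ.
Qed.

Lemma linear_etop_continuous (E F : euclidean R) (f : {linear E -> F}) :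
  continuous (f : etop E -> etop F).
Proof.
have [C C0 fC] := linear_le f => x.
apply/(@cvgrPdist_le _ _ _ (nbhs (x : etop E))) => e e0; near=> z.
have : `|(x : etop E) - z| <= e / C.
  by near: z; apply: cvgr_dist_le; rewrite // divr_gt0.
rewrite !etop_normE ler_pdivlMr // => H.
have := fC ((x : E) - z); rewrite linearB mulrC => H2.
exact: le_trans H2 H.
Unshelve. all: by end_near. Qed.

Lemma closed_bounded_compact (E : euclidean R) (A : set (etop E)) (C : R) :
  closed A -> (forall x, A x -> `|x| <= C) -> compact A.
Proof.
move=> cA bA.
have [e [oe eE]] := ex_orthonormal_basis (edot E).
pose n := \dim {:E}.
pose phi (r : 'rV[R]_n) : etop E := \sum_k r 0 k *: (e k : etop E).
have phiB r t : phi r - phi t = phi (r - t).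
  by rewrite /phi -sumrB; apply: eq_bigr => k _; rewrite !mxE scalerBl.
have phi_le r : `|phi r| <= n%:R * `|r|.
  have -> : n%:R * `|r| = \sum_(k < n) `|r| by rewrite sumr_const card_ord mulr_natl.
  rewrite (le_trans (ler_norm_sum _ _ _)) // ler_sum // => k _.
  rewrite normrZ etop_normE /dnorm oe eqxx sqrtr1 mulr1.
  by rewrite [leRHS]/Num.norm /= mx_normrE; apply: (le_trans _ (le_bigmax _ _ (0, k))).
have phic : continuous phi.
  move=> r; apply/(@cvgrPdist_le _ _ _ (nbhs r)) => d d0; near=> t.
  have : `|r - t| <= d / (n%:R + 1).
    by near: t; apply: cvgr_dist_le; rewrite // divr_gt0 // ltr_pwDr.
  rewrite ler_pdivlMr ?ltr_pwDr // phiB => H; apply: le_trans (phi_le _) _.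
  by apply: le_trans H; rewrite mulrC ler_wpM2l // lerDl.
have phiK (x : E) : phi (\row_k edot E x (e k)) = x.
  by rewrite [RHS]eE; apply: eq_bigr => k _; rewrite mxE.
have phi_coord r k : edot E (phi r) (e k) = r 0 k.
  rewrite /phi dot_suml (bigD1 k) //= dotZl oe eqxx mulr1 big1 ?addr0 // => j jk.
  by rewrite dotZl oe (negbTE jk) mulr0.
have -> : A = phi @` (phi @^-1` A).
  apply/seteqP; split=> [x Ax|_ [r Ar <-]] //.
  by exists (\row_k edot E x (e k)); rewrite /= phiK.
apply: continuous_compact; first by apply: continuous_subspaceT => x; exact: phic.
apply: bounded_closed_compact; last first.
  by apply: closed_comp => // r _; exact: phic.
exists `|C|; split; first exact: normr_real.
move=> M CM r /= Ar; rewrite [leLHS]/Num.norm /= mx_normrE.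
have M0 : 0 <= M by rewrite ltW // (le_lt_trans _ CM).
apply/bigmax_leP; split=> // -[i k] _ /=; rewrite (ord1 i) -phi_coord.
rewrite (le_trans (dot_CauchySchwarz _ _ _)) // {2}/dnorm oe eqxx sqrtr1 mulr1.
by rewrite (le_trans (bA _ Ar)) // (le_trans (ler_norm C)) // ltW.
Unshelve. all: by end_near. Qed.

Lemma norm_ge (E : euclidean R) (N : E -> R) : is_norm N ->
  exists2 c, 0 < c & forall x, c * dnorm (edot E) x <= N x.
Proof.
move=> [ND NZ N0].
pose S : set (etop E) := [set x | `|x| = 1].
have cS : compact S.
  apply: (@closed_bounded_compact _ _ 1) => [|x /= ->//].
  have -> : S = (fun x : etop E => `|x|) @^-1` [set 1] by [].
  by apply: closed_comp; [move=> x _; exact: norm_continuous|exact: closed_eq].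
have [S0|/set0P/negP/negPn/eqP S0] := pselect (S !=set0); last first.
  exists 1 => // x; have [->|x0] := eqVneq x 0.
    by rewrite /dnorm dot0l sqrtr0 mulr0 seminorm_ge0.
  have dx : 0 < dnorm (edot E) x by rewrite sqrtr_gt0 dot_gt0.
  suff : S ((dnorm (edot E) x)^-1 *: x) by rewrite S0.
  by rewrite /S /= etop_normE dnormZ normfV gtr0_norm // mulVf // gt_eqF.
have [y Sy ymin] := @compact_EVT_min (etop E) R N S S0 cS
  (continuous_subspaceT (seminorm_continuous ND NZ)).
rewrite inE in Sy.
have Ny : 0 < N y.
  rewrite lt0r seminorm_ge0 // andbT; apply/eqP => /N0 y0.
  by move: Sy; rewrite /S /= y0 etop_normE /dnorm dot0l sqrtr0 => /esym/eqP; rewrite oner_eq0.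
exists (N y) => // x; have [->|x0] := eqVneq x 0.
  by rewrite /dnorm dot0l sqrtr0 mulr0 seminorm_ge0.
have dx : 0 < dnorm (edot E) x by rewrite sqrtr_gt0 dot_gt0.
have := ymin ((dnorm (edot E) x)^-1 *: x).
rewrite NZ normfV gtr0_norm // mulrC ler_pdivlMr //; apply.
by rewrite inE /S /= etop_normE dnormZ normfV gtr0_norm // mulVf // gt_eqF.
Qed.

End Topology.

Section Bodies.
Variables (R : realType).

Lemma convex_setE (V : lmodType R) (P : set V) : convex_set P <->
  forall x y (t : R), 0 <= t -> t <= 1 -> P x -> P y -> P (t *: x + (1 - t) *: y).
Proof.
split=> [cP x y t t0 t1 Px Py|cP x y t].
  by have /(_ (Itv01 t0 t1)) := cP x y _ (mem_set Px) (mem_set Py); rewrite inE.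
by rewrite !inE => Px Py; apply: cP.
Qed.

Lemma zero_symmetricP (V : vectType R) (P : set V) :
  zero_symmetric P <-> forall x, P x -> P (- x).
Proof.
split=> [PE x Px|PN]; first by rewrite PE; exists x.
apply/seteqP; split=> [x Px|_ [x Px <-]]; last exact: PN.
by exists (- x); [exact: PN|rewrite opprK].
Qed.

Lemma sym_body_ball (E : euclidean R) (P : sym_body E) :
  exists2 r, 0 < r & forall x, dnorm (edot E) x <= r -> body_set P x.
Proof.
have [cP _ [a]] := body_convex P; rewrite /interior => /nbhs_ballP[r /= r0 rP].
have /zero_symmetricP sP := body_sym P; move/convex_setE in cP.
exists (r / 2) => [|x xr]; first by rewrite divr_gt0.
have xr' : dnorm (edot E) x < r by rewrite (le_lt_trans xr) // ltr_pdivrMr // ltr_pMr // ltr1n.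
have xP : body_set P (a + x).
  apply: rP; rewrite -ball_normE /ball_ /= opprD addNKr normrN; exact: xr'.
have xP' : body_set P (x - a).
  rewrite -[x - a]opprB; apply: sP; apply: rP.
  rewrite -ball_normE /ball_ /= opprB addrC subrK; exact: xr'.
have h0 : (0 : R) <= 2^-1 by rewrite invr_ge0.
have h1 : (2^-1 : R) <= 1 by rewrite invf_le1 // ler1n.
have := cP _ _ _ h0 h1 xP xP'.
have -> : (1 - 2^-1 : R) = 2^-1 by lra.
have -> // : 2^-1 *: (a + x : ecarrier E) + 2^-1 *: (x - a : ecarrier E) = x.
have -> : x - a = - a + x by rewrite addrC.
rewrite -scalerDr addrACA subrr add0r scalerDr -scalerDl.
by rewrite (_ : 2^-1 + 2^-1 = 1 :> R) ?scale1r //; lra.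
Qed.

Lemma sym_body0 (E : euclidean R) (P : sym_body E) : body_set P 0.
Proof.
have [r r0] := sym_body_ball P; apply.
by rewrite /dnorm dot0l sqrtr0 ltW.
Qed.

Lemma sym_body_bounded (E : euclidean R) (P : sym_body E) :
  exists2 C, 0 < C & forall x, body_set P x -> dnorm (edot E) x <= C.
Proof.
have [_ /compact_bounded[M [_ HM]] _] := body_convex P.
exists (`|M| + 1) => [|x Px]; first by rewrite ltr_wpDl.
by apply: (HM (`|M| + 1)) => //; rewrite (le_lt_trans (ler_norm _)) // ltrDl.
Qed.

Lemma sym_body_closed (E : euclidean R) (P : sym_body E) : closed (P : set (etop E)).
Proof.
have [_ cP _] := body_convex P; apply: compact_closed cP; exact: norm_hausdorff.
Qed.

Lemma convex_body_intro (E : euclidean R) (P : set E) (C r : R) :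
  convex_set P -> closed (P : set (etop E)) ->
  (forall x, P x -> dnorm (edot E) x <= C) ->
  0 < r -> (forall x, dnorm (edot E) x < r -> P x) -> convex_body P.
Proof.
move=> cP clP bP r0 rP; split=> //; first exact: closed_bounded_compact bP.
exists 0; apply/nbhs_ballP; exists r => //= x.
by rewrite -ball_normE /ball_ /= sub0r normrN => ?; exact: rP.
Qed.

Definition polar (E : euclidean R) (C : set E) : set E :=
  [set y | (ereal_sup [set (edot E x y)%:E | x in C] <= 1)%E].

Lemma polarP (E : euclidean R) (C : set E) y :
  polar C y <-> forall x, C x -> edot E x y <= 1.
Proof.
split=> [Cy x Cx|Cy].
  by rewrite -lee_fin; apply: le_trans Cy; apply: ereal_sup_ubound; exists x.
by apply: ge_ereal_sup => _ [x Cx <-]; rewrite lee_fin; exact: Cy.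
Qed.

Lemma polar_convex_body (E : euclidean R) (P : sym_body E) : convex_body (polar P).
Proof.
have [r r0 rP] := sym_body_ball P; have [C C0 PC] := sym_body_bounded P.
apply: (@convex_body_intro _ _ r^-1 C^-1).
- apply/convex_setE => x y t t0 t1 /polarP Px /polarP Py; apply/polarP => z Pz.
  rewrite dotDr !dotZr.
  apply: (@le_trans _ _ (t * 1 + (1 - t) * 1)); last by lra.
  by rewrite lerD // ler_wpM2l ?subr_ge0 ?Px ?Py.
- have -> : polar P = \bigcap_(x in P) [set y | edot E x y <= 1].
    by apply/seteqP; split=> y => [/polarP//|Py]; apply/polarP.
  apply: closed_bigI => x _.
  have -> : [set y | edot E x y <= 1] = (edot E x : etop E -> R) @^-1` [set t | t <= 1] by [].
  apply: closed_comp; last exact: closed_le.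
  have xD y z : `|edot E x (y + z)| <= `|edot E x y| + `|edot E x z|.
    by rewrite dotDr ler_normD.
  have xZ a y : `|edot E x (a *: y)| = `|a| * `|edot E x y| by rewrite dotZr normrM.
  move=> y _; have [c c0 xc] := seminorm_le xD xZ.
  apply/(@cvgrPdist_le _ _ _ (nbhs (y : etop E))) => e e0; near=> z.
  have : `|(y : etop E) - z| <= e / c.
    by near: z; apply: cvgr_dist_le; rewrite // divr_gt0.
  rewrite etop_normE ler_pdivlMr // mulrC => H; apply: le_trans H.
  by have := xc (y - z); rewrite dotDr -scaleN1r dotZr mulN1r.
- move=> y /polarP Py; have [->|y0] := eqVneq y 0.
    by rewrite /dnorm dot0l sqrtr0 invr_ge0 ltW.
  have dy : 0 < dnorm (edot E) y by rewrite sqrtr_gt0 dot_gt0.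
  have : edot E ((r / dnorm (edot E) y) *: y) y <= 1.
    apply: Py; apply: rP.
    by rewrite dnormZ ger0_norm ?divr_ge0 ?(ltW r0) ?(ltW dy) // divfK // gt_eqF.
  rewrite dotZl -dnorm_sqr expr2 mulrA divfK ?gt_eqF //.
  by rewrite -[r^-1]mul1r ler_pdivlMr // mulrC.
- by rewrite invr_gt0.
- move=> y yC; apply/polarP => x Px.
  rewrite (le_trans (ler_norm _)) // (le_trans (dot_CauchySchwarz _ _ _)) //.
  apply: (@le_trans _ _ (C * C^-1)); last by rewrite divff ?gt_eqF.
  by rewrite ler_pM ?dnorm_ge0 ?PC // ltW.
Unshelve. all: by end_near. Qed.

Lemma polar_sym (E : euclidean R) (P : sym_body E) : zero_symmetric (polar P).
Proof.
apply/zero_symmetricP => y /polarP Py; apply/polarP => x Px.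
rewrite -scaleN1r dotZr -dotZl scaleN1r; apply: Py.
by have /zero_symmetricP := body_sym P; apply.
Qed.

Definition polar_body (E : euclidean R) (P : sym_body E) : sym_body E :=
  SymBody (polar_convex_body P) (polar_sym P).

Section SubBody.
Variables (E : euclidean R) (M : {vspace E}).

Definition sub_dot_fun (x y : subvs_of M) : R := edot E (vsval x) (vsval y).

Fact sub_dot_funC x y : sub_dot_fun x y = sub_dot_fun y x.
Proof. exact: dotC. Qed.
Fact sub_dot_funP a x y z :
  sub_dot_fun (a *: x + y) z = a * sub_dot_fun x z + sub_dot_fun y z.
Proof. by rewrite /sub_dot_fun linearP dotP. Qed.
Fact sub_dot_fun_gt0 x : x != 0 -> 0 < sub_dot_fun x x.
Proof. by move=> x0; apply: dot_gt0; rewrite -(linear0 (vsval : subvs_of M -> E)) (inj_eq subvs_inj). Qed.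

Definition sub_euclidean : euclidean R :=
  Euclidean (mk_dot sub_dot_funC sub_dot_funP sub_dot_fun_gt0).

Lemma sub_dnorm (x : sub_euclidean) : dnorm (edot sub_euclidean) x = dnorm (edot E) (vsval x).
Proof. by []. Qed.

Variable P : sym_body E.

Lemma sub_convex_body : convex_body ([set x | body_set P (vsval x)] : set sub_euclidean).
Proof.
have [r r0 rP] := sym_body_ball P; have [C C0 PC] := sym_body_bounded P.
have [/convex_setE cP _ _] := body_convex P.
apply: (@convex_body_intro _ _ C r) => //.
- have vE (x y : subvs_of M) (t : R) :
      vsval (t *: x + (1 - t) *: y) = t *: vsval x + (1 - t) *: vsval y.
    by rewrite linearD !linearZ.
  apply/convex_setE => x y t t0 t1 Px Py.
  by have := cP _ _ _ t0 t1 Px Py; rewrite -vE.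
- apply: (@closed_comp (etop sub_euclidean) (etop E) vsval P).
    move=> x _; exact: (@linear_etop_continuous _ sub_euclidean E vsval).
  exact: sym_body_closed.
- by move=> x /= Px; rewrite sub_dnorm PC.
- by move=> x xr; apply: rP; rewrite -sub_dnorm ltW.
Qed.

Lemma sub_sym : zero_symmetric ([set x | body_set P (vsval x)] : set sub_euclidean).
Proof.
have vN (x : subvs_of M) : vsval (- x) = - vsval x by rewrite linearN.
have /zero_symmetricP sP := body_sym P.
by apply/zero_symmetricP => x Px; have := sP _ Px; rewrite -vN.
Qed.

Definition sub_body : sym_body sub_euclidean := SymBody sub_convex_body sub_sym.
End SubBody.

Section ImageBody.
Variables (E F : euclidean R) (T : 'Hom(E, F)) (P : sym_body E).
Hypothesis T_surj : limg T = fullv.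

Lemma image_convex_body : convex_body (T @` P).
Proof.
have [r r0 rP] := sym_body_ball P; have [C C0 PC] := sym_body_bounded P.
have [/convex_setE cP kP _] := body_convex P.
split.
- apply/convex_setE => _ _ t t0 t1 [x Px <-] [y Py <-].
  by exists (t *: x + (1 - t) *: y); [exact: cP|rewrite linearD !linearZ].
- apply: (@continuous_compact (etop E) (etop F) T P) => //.
  apply: continuous_subspaceT; exact: (@linear_etop_continuous _ E F T).
- have [c c0 Tc] := @linear_le _ F E (T^-1)%VF.
  exists 0; apply/nbhs_ballP; exists (r / c) => /=; first by rewrite divr_gt0.
  move=> y; rewrite -ball_normE /ball_ /= sub0r normrN etop_normE => yr.
  exists ((T^-1)%VF y); last by rewrite limg_lfunVK // T_surj memvf.
  apply: rP; rewrite (le_trans (Tc y)) // mulrC -ler_pdivlMr // ltW //.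
Qed.

Lemma image_sym : zero_symmetric (T @` P).
Proof.
apply/zero_symmetricP => _ [x Px <-]; exists (- x); last by rewrite linearN.
by have /zero_symmetricP := body_sym P; apply.
Qed.

Definition image_body : sym_body F := SymBody image_convex_body image_sym.
End ImageBody.

Section BallBody.
Variables (M : banach R) (s : {dot M for idfun}).

Lemma ball_convex_body :
  convex_body ([set x | bnorm x <= 1] : set (Euclidean s)).
Proof.
have nP := bnormP M; have [ND NZ N0] := nP.
have [C C0 NC] := @seminorm_le _ (Euclidean s) _ ND NZ.
have [c c0 cN] := @norm_ge _ (Euclidean s) _ nP.
apply: (@convex_body_intro _ _ c^-1 C^-1).
- apply/convex_setE => x y t t0 t1 Px Py /=; rewrite (le_trans (ND _ _)) // !NZ.
  rewrite ger0_norm // (@ger0_norm _ (1 - t)) ?subr_ge0 //.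
  apply: (@le_trans _ _ (t * 1 + (1 - t) * 1)); last by lra.
  by rewrite lerD // ler_wpM2l ?subr_ge0.
- apply: (@closed_comp (etop (Euclidean s)) R (@bnorm _ M) [set t | t <= 1]).
    move=> x _; exact: (@seminorm_continuous _ (Euclidean s)).
  exact: closed_le.
- move=> x /= Nx; rewrite -[c^-1]mul1r ler_pdivlMr // mulrC.
  exact: le_trans (cN x) Nx.
- by rewrite invr_gt0.
- move=> x xC /=; rewrite (le_trans (NC _)) // mulrC -ler_pdivlMr // div1r ltW //.
Qed.

Lemma ball_sym : zero_symmetric ([set x | bnorm x <= 1] : set (Euclidean s)).
Proof.
apply/zero_symmetricP => x /=; have [_ NZ _] := bnormP M.
by rewrite -scaleN1r NZ normrN1 mul1r.
Qed.

Definition ball_body : sym_body (Euclidean s) := SymBody ball_convex_body ball_sym.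
End BallBody.

Definition std_dot_fun (V : vectType R) (x y : V) : R :=
  \sum_k stdcoord k x * stdcoord k y.

Fact std_dot_funC (V : vectType R) (x y : V) : std_dot_fun x y = std_dot_fun y x.
Proof. by apply: eq_bigr => k _; rewrite mulrC. Qed.
Fact std_dot_funP (V : vectType R) a (x y z : V) :
  std_dot_fun (a *: x + y) z = a * std_dot_fun x z + std_dot_fun y z.
Proof.
rewrite /std_dot_fun mulr_sumr -big_split; apply: eq_bigr => k _ /=.
by rewrite stdcoordP mulrDl mulrA.
Qed.
Fact std_dot_fun_gt0 (V : vectType R) (x : V) : x != 0 -> 0 < std_dot_fun x x.
Proof.
move=> x0; rewrite lt0r; apply/andP; split; last first.
  by apply: sumr_ge0 => k _; rewrite -expr2 sqr_ge0.
apply: contraNneq x0 => /eqP.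
rewrite psumr_eq0 => [/allP cx0|k _]; last by rewrite -expr2 sqr_ge0.
rewrite (stdcoordK x) big1 // => k _.
by have := cx0 k (mem_index_enum k); rewrite /= mulf_eq0 orbb => /eqP ->; rewrite scale0r.
Qed.
Definition std_dot (V : vectType R) : {dot V for idfun} :=
  mk_dot (@std_dot_funC V) (@std_dot_funP V) (@std_dot_fun_gt0 V).

Lemma banach_le (M : banach R) (N : M -> R) :
  (forall x y, N (x + y) <= N x + N y) -> (forall a x, N (a *: x) = `|a| * N x) ->
  exists2 C, 0 < C & forall x, N x <= C * bnorm x.
Proof.
move=> ND NZ.
have [C C0 NC] := @seminorm_le _ (Euclidean (std_dot M)) _ ND NZ.
have [c c0 cN] := @norm_ge _ (Euclidean (std_dot M)) _ (bnormP M).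
exists (C / c) => [|x]; first by rewrite divr_gt0.
rewrite (le_trans (NC x)) // -mulrA ler_wpM2l ?(ltW C0) // mulrC ler_pdivlMr // mulrC.
exact: cN.
Qed.

Definition dual_norm (M : banach R) (f : 'Hom(M, R^o)) : R :=
  sup [set `|f x| | x in [set x | bnorm x <= 1]].

Lemma bnorm0 (M : banach R) : bnorm (0 : M) = 0.
Proof. by have [_ NZ _] := bnormP M; rewrite -(scale0r 0) NZ normr0 mul0r. Qed.

Lemma dual_norm_has_sup (M : banach R) (f : 'Hom(M, R^o)) :
  has_sup [set `|f x| | x in [set x | bnorm x <= 1]].
Proof.
split; first by exists `|f 0|, 0 => //=; rewrite bnorm0.
have fD x y : `|f (x + y)| <= `|f x| + `|f y| by rewrite linearD ler_normD.
have fZ a x : `|f (a *: x)| = `|a| * `|f x| by rewrite linearZ normrM.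
have [C C0 fC] := banach_le fD fZ.
exists C => _ [x /= x1 <-]; rewrite (le_trans (fC x)) // ler_piMr ?(ltW C0) //.
Qed.

Lemma dual_norm_ub (M : banach R) (f : 'Hom(M, R^o)) x :
  bnorm x <= 1 -> `|f x| <= dual_norm f.
Proof. by move=> x1; apply: ub_le_sup; [case: (dual_norm_has_sup f)|exists x]. Qed.

Lemma dual_norm_le (M : banach R) (f : 'Hom(M, R^o)) C :
  (forall x, bnorm x <= 1 -> `|f x| <= C) -> dual_norm f <= C.
Proof.
move=> fC; apply: ge_sup; first by case: (dual_norm_has_sup f).
by move=> _ [x x1 <-]; exact: fC.
Qed.

Lemma dual_norm_is_norm (M : banach R) : is_norm (@dual_norm M).
Proof.
split=> [f g|a f|f f0].
- apply: dual_norm_le => x x1; rewrite lfunE /= (le_trans (ler_normD _ _)) //.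
  by rewrite lerD ?dual_norm_ub.
- have le_dZ b (g : 'Hom(M, R^o)) : dual_norm (b *: g) <= `|b| * dual_norm g.
    apply: dual_norm_le => x x1; rewrite lfunE /= normrM ler_wpM2l //.
    exact: dual_norm_ub.
  apply/le_anti/andP; split=> //.
  have [->|a0] := eqVneq a 0.
    rewrite normr0 mul0r; apply: le_trans (dual_norm_ub _ (_ : bnorm 0 <= 1)) => //.
    by rewrite bnorm0.
  rewrite -ler_pdivlMl ?normr_gt0 // -normfV; apply: le_trans (le_dZ _ _).
  by rewrite scalerA mulVf // scale1r.
- have [_ NZ N0] := bnormP M; apply/lfunP => x; rewrite lfunE /=.
  have [->|x0] := eqVneq x 0; first by rewrite linear0.
  have Nx : 0 < bnorm x.
    rewrite lt0r (contra_neq (N0 x)) //=; have [ND _ _] := bnormP M.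
    exact: (@seminorm_ge0 _ (Euclidean (std_dot M)) _ ND NZ).
  have /(dual_norm_ub f) : bnorm ((bnorm x)^-1 *: x) <= 1.
    by rewrite NZ normfV gtr0_norm // mulVf // gt_eqF.
  rewrite f0 normr_le0 linearZ /= mulf_eq0 invr_eq0 gt_eqF //= => /eqP //.
Qed.

Definition dual_banach (M : banach R) : banach R := Banach (@dual_norm_is_norm M).

Lemma sub_norm_is_norm (M : banach R) (E : {vspace M}) :
  is_norm (fun x : subvs_of E => bnorm (vsval x)).
Proof.
have [ND NZ N0] := bnormP M; split=> [x y|a x|x x0].
- by rewrite linearD.
- by rewrite linearZ NZ.
- by apply: subvs_inj; rewrite linear0; exact: N0.
Qed.

Definition sub_banach (M : banach R) (E : {vspace M}) : banach R :=
  Banach (sub_norm_is_norm E).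
End Bodies.

Section TensorMaps.
Variables (R : realType) (l : nat).
Implicit Types V W : 'I_l -> vectType R.

Definition tmap V W (T : forall i, 'Hom(V i, W i)) : 'Hom(tensor V, tensor W) :=
  linfun (tlift (fun x => tprod (fun i => T i (x i)))).

Lemma tmap_tprod V W (T : forall i, 'Hom(V i, W i)) x :
  tmap T (tprod x) = tprod (fun i => T i (x i)).
Proof.
rewrite lfunE /= tlift_tprod // => y i a z t.
have E w : (fun j => T j (@dfwith _ V y i w j)) =
    @dfwith _ W (fun j => T j (y j)) i (T i w).
  apply: functional_extensionality_dep => j.
  by have [->|ij] := eqVneq j i; rewrite ?dfwith_in // !dfwith_out 1?eq_sym.
by rewrite !E linearP tprod_multilinear.
Qed.

Definition tfunctional V (f : forall i, 'Hom(V i, R^o)) (u : tensor V) : R^o :=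
  tlift (fun x => \prod_i f i (x i) : R^o) u.

Lemma tfunctional_tprod V (f : forall i, 'Hom(V i, R^o)) x :
  tfunctional f (tprod x) = \prod_i f i (x i).
Proof.
rewrite /tfunctional tlift_tprod //.
by apply: (multilinear_prod (g := fun i x => f i x)) => i a y z; rewrite linearP.
Qed.

(* The action on a tensor u of an element of the tensor product of the duals. *)
Definition tpairing V (phi : tensor (fun i => 'Hom(V i, R^o) : vectType R)) (u : tensor V) : R^o :=
  tlift (fun f => tfunctional f u) phi.

Lemma tpairing_tprod V (f : forall i, 'Hom(V i, R^o)) u :
  tpairing (tprod (V := fun i => 'Hom(V i, R^o) : vectType R) f) u = tfunctional f u.
Proof.
rewrite /tpairing tlift_tprod // => g i a y z.
rewrite /tfunctional /tlift scaler_sumr -big_split; apply: eq_bigr => j _ /=.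
rewrite scalerA [a * _]mulrC -scalerA -scalerDr; congr (_ *: _).
apply: (@multilinear_prod R l (fun i => 'Hom(V i, R^o) : vectType R)
  (fun i h => h (stdbasis (j i)))) => k b h h'.
by rewrite lfunE /= lfunE.
Qed.
End TensorMaps.

Section BodyTensorProducts.
Variables (R : realType) (l : nat).
Implicit Types E F : 'I_l -> euclidean R.

Definition tensor_euclidean E : euclidean R :=
  Euclidean (tensor_dot (fun i => edot (E i))).

(* [smallest (@convex_set R _) A] is the convex hull of A. *)
Definition pi_prod E (P : forall i, set (E i)) : set (tensor_euclidean E) :=
  smallest (@convex_set R (tensor E)) [set tprod x | x in [set x | forall i, P i (x i)]].

Definition eps_prod E (P : forall i, set (E i)) : set (tensor_euclidean E) :=
  polar (pi_prod (fun i => polar (P i))).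

Record body_tensor_product := BodyTensorProduct {
  btprod :> forall E, (forall i, sym_body (E i)) -> sym_body (tensor_euclidean E);
  btprod_pi : forall E (P : forall i, sym_body (E i)), pi_prod P `<=` btprod P;
  btprod_eps : forall E (P : forall i, sym_body (E i)), btprod P `<=` eps_prod P;
  btprod_uniform : forall E F (T : forall i, 'Hom(E i, F i))
      (P : forall i, sym_body (E i)) (Q : forall i, sym_body (F i)),
    (forall i, T i @` P i `<=` Q i) -> tmap T @` btprod P `<=` btprod Q }.

Definition is_dual_product (a b : body_tensor_product) :=
  forall E (P : forall i, sym_body (E i)),
    b E P = polar (a E (fun i => polar_body (P i))) :> set _.

(* [tmap (fun i => incl (M i))] embeds the tensor product of the subspaces M_i in
   the tensor product of the ambient spaces. *)
Definition incl (V : vectType R) (M : {vspace V}) : 'Hom(subvs_of M, V) := linfun vsval.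

Definition injective_product (a : body_tensor_product) :=
  forall E (P : forall i, sym_body (E i)) (M : forall i, {vspace E i}),
    tmap (fun i => incl (M i)) @` a _ (fun i => sub_body (M i) (P i)) =
    a E P `&` range (tmap (fun i => incl (M i))).

Definition projective_product (a : body_tensor_product) :=
  forall E F (P : forall i, sym_body (E i)) (T : forall i, 'Hom(E i, F i))
    (T_surj : forall i, limg (T i) = fullv),
    tmap T @` a E P = a F (fun i => image_body (P i) (T_surj i)).
End BodyTensorProducts.

Section TensorNorms.
Variables (R : realType) (l : nat).
Implicit Types M N : 'I_l -> banach R.

Definition gauge (V : vectType R) (P : set V) (x : V) : R :=
  inf [set k | 0 < k /\ P (k^-1 *: x)].

Definition pi_norm M (u : tensor M) : R :=
  inf [set r | exists n (x : 'I_n -> forall i, M i),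
    u = \sum_j tprod (x j) /\ r = \sum_j \prod_i bnorm (x j i)].

Definition eps_norm M (u : tensor M) : R :=
  sup [set `|tfunctional f u| | f in [set f | forall i, dual_norm (f i) <= 1]].

Definition opnorm (V W : vectType R) (NV : V -> R) (NW : W -> R) (T : 'Hom(V, W)) : R :=
  sup [set NW (T x) | x in [set x | NV x <= 1]].

Record tensor_norm := TensorNorm {
  tnorm :> forall M, tensor M -> R;
  tnorm_norm : forall M, is_norm (@tnorm M);
  tnorm_eps : forall M (u : tensor M), eps_norm u <= tnorm u;
  tnorm_pi : forall M (u : tensor M), tnorm u <= pi_norm u;
  tnorm_map : forall M N (T : forall i, 'Hom(M i, N i)),
    opnorm (@tnorm M) (@tnorm N) (tmap T) <=
    \prod_i opnorm (@bnorm _ (M i)) (@bnorm _ (N i)) (T i) }.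

Definition is_dual_norm (a b : tensor_norm) :=
  forall M (u : tensor M),
    b M u = sup [set `|tpairing phi u| | phi in
      [set phi | a (fun i => dual_banach (M i)) phi <= 1]].

Definition injective_norm (a : tensor_norm) :=
  forall M (E : forall i, {vspace M i}) (u : tensor (fun i => sub_banach (E i))),
    a M (tmap (fun i => incl (E i)) u) = a (fun i => sub_banach (E i)) u.

Definition quotient_operator (V W : vectType R) (NV : V -> R) (NW : W -> R)
    (S : 'Hom(V, W)) :=
  S @` [set x | NV x < 1] = [set y | NW y < 1].

Definition projective_norm (a : tensor_norm) :=
  forall M N (S : forall i, 'Hom(M i, N i)),
    (forall i, quotient_operator (@bnorm _ (M i)) (@bnorm _ (N i)) (S i)) ->
    quotient_operator (a M) (a N) (tmap S).
End TensorNorms.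

(* Main.v *)
Require Import Defs.
From HB Require Import structures.
From mathcomp Require Import all_boot all_order all_algebra.
From mathcomp Require Import boolp classical_sets functions reals ereal.
From mathcomp Require Import topology normedtype convex derive.
From mathcomp Require Import ring lra.
Import numFieldNormedType.Exports.
Import Order.TTheory GRing.Theory Num.Theory.
Set Implicit Arguments.
Unset Strict Implicit.
Unset Printing Implicit Defensive.
Local Open Scope classical_set_scope.
Local Open Scope ring_scope.

(** Everything rests on the dictionary between a norm and its closed unit ball:
    a symmetric convex body is the unit ball of its gauge ([gauge_le],
    [gauge_is_norm]), and a norm is the gauge of its unit ball ([gauge_ball]).
    On the factors it turns bodies P_i into Banach spaces and back; on the tensor
    product it turns the axioms of a tensor product of bodies into those of a
    tensor norm. The scalar products on the factors cannot matter, because the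
    identity maps between two choices satisfy the uniform property in both
    directions ([btprod_change_dot]).

    The bound from below by the injective norm comes from the Riesz representation:
    a functional f_i of dual norm at most 1 is the scalar product with a point y_i
    of the polar of the unit ball, and the product functional of the f_i is the
    scalar product with the elementary tensor of the y_i
    ([dual_norm_riesz], [tfunctional_riesz]). The bound by the projective norm is
    subadditivity, and the uniform property is the bound on operator norms after
    each T_i has been divided by its norm ([body_norm_map]). The two constructions
    [norm_of_product] and [product_of_norm] are then mutually inverse, since each
    of them passes to the gauge and back.

    For duality, the tensor product of the Riesz maps carries the body built on
    the polars onto the unit ball of the norm built on the dual spaces, and it
    carries the scalar product to the pairing ([body_norm_riesz],
    [tpairing_riesz]); the dual norm is therefore the gauge of the polar
    ([gauge_polar]). For injectivity, both notions say that a tensor of the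
    subspaces has norm at most 1 exactly when its image has; the embedding of
    tensor products is injective because the factors have left inverses. For
    projectivity, a map between finite dimensional normed spaces is a quotient
    operator exactly when it maps the closed unit ball onto the closed unit ball
    ([quotient_operatorP]), and this is what the body condition says. *)

(** * Gauges of symmetric convex bodies *)

Section Gauge.
Import Defs.
Variable R : realType.

(** A gauge is best known through its positive upper bounds, so equalities between
    gauges and norms are proved by comparing these. *)
Lemma eq_le_pos (a b : R) : 0 <= a -> 0 <= b ->
  (forall k, 0 < k -> (a <= k <-> b <= k)) -> a = b.
Proof.
move=> a0 b0 ab; apply/le_anti/andP; split; apply/ler_addgt0Pr => e e0.
  by apply/ab; rewrite ?ltr_wpDl // lerDl ltW.
by apply/ab; rewrite ?ltr_wpDl // lerDl ltW.
Qed.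

Lemma gauge_ge0 (V : vectType R) (P : set V) x : 0 <= gauge P x.
Proof.
rewrite /gauge.
have [->|/set0P P0] := eqVneq [set k : R | 0 < k /\ P (k^-1 *: x)] set0.
  by rewrite inf0.
by apply: lb_le_inf => // k [/ltW].
Qed.

Variables (E : euclidean R) (B : sym_body E).
Local Notation P := (body_set B).

Lemma body_scale a x : `|a| <= 1 -> P x -> P (a *: x).
Proof.
move=> a1 Px; have [/convex_setE cP _ _] := body_convex B.
have PN : P (- x) by have /zero_symmetricP := body_sym B; apply.
move: a1; rewrite ler_norml => /andP[a1 a2].
have := cP _ _ ((1 + a) / 2) _ _ Px PN.
have -> : ((1 + a) / 2) *: x + (1 - (1 + a) / 2) *: - x = a *: x.
  by rewrite scalerN -scalerBl; congr (_ *: _); field.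
by apply; lra.
Qed.

(** A body contains a ball around 0, so a small multiple of each x lies in it. *)
Lemma body_absorb x : exists2 k, 0 < k & P (k^-1 *: x).
Proof.
have [r r0 rP] := sym_body_ball B.
have d0 := dnorm_ge0 (edot E) x.
exists ((dnorm (edot E) x + 1) / r); first by rewrite divr_gt0 // ltr_wpDl.
apply: rP; rewrite dnormZ normfV ger0_norm ?divr_ge0 ?addr_ge0 ?(ltW r0) //.
rewrite invf_div mulrAC ler_pdivrMr ?ltr_wpDl //.
by rewrite ler_wpM2l ?(ltW r0) // lerDl.
Qed.

(** The infimum that defines the gauge is attained, because the body is closed: if
    k^-1 x were outside, then so would be its multiples by factors close to 1, but
    multiples by factors below 1 are inside by symmetry and convexity. *)
Lemma gauge_le x k : 0 < k -> gauge P x <= k <-> P (k^-1 *: x).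
Proof.
move=> k0; split=> [xk|Pk]; last first.
  by apply: ge_inf => //; exists 0 => j [/ltW].
have Pj j : k < j -> P (j^-1 *: x).
  move=> kj; have j0 : 0 < j by exact: lt_trans kj.
  have hi : has_inf [set k : R | 0 < k /\ P (k^-1 *: x)].
    split; last by exists 0 => i [/ltW].
    by have [i i0 Pi] := body_absorb x; exists i.
  have [|i [i0 Pi] ij] := @inf_adherent _ _ (j - gauge P x) _ hi.
    by rewrite subr_gt0 (le_lt_trans xk).
  have {}ij : i < j by rewrite /gauge in ij; lra.
  have -> : j^-1 *: x = (i / j) *: (i^-1 *: x).
    by rewrite scalerA mulrAC divff ?gt_eqF // mul1r.
  apply: body_scale => //.
  by rewrite ger0_norm ?divr_ge0 ?ltW // ltr_pdivrMr // mul1r.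
set y := k^-1 *: x in Pj *.
have Pt t : 0 < t -> t < 1 -> P (t *: y).
  move=> t0 t1; have := Pj (k / t); rewrite invf_div /y scalerA; apply.
  by rewrite ltr_pdivlMr // -[ltRHS]mulr1 ltr_pM2l.
apply: contrapT => nP.
have : nbhs (y : etop E) (~` (P : set (etop E))).
  by apply: open_nbhs_nbhs; split => //; rewrite openC; exact: sym_body_closed.
move=> /nbhs_ballP[r /= r0 rP].
have d0 := dnorm_ge0 (edot E) y.
(* [t] is so close to 1 that [t *: y] is at distance less than [r] from [y]. *)
have D0 : 0 < dnorm (edot E) y + 1 + r by lra.
pose t := (dnorm (edot E) y + 1) / (dnorm (edot E) y + 1 + r).
have t0 : 0 < t by rewrite divr_gt0 //; lra.
have t1 : t < 1 by rewrite ltr_pdivrMr //; lra.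
apply: (rP (t *: y)); last exact: Pt.
rewrite -ball_normE /ball_ /= etop_normE -[X in X - _]scale1r -scalerBl.
rewrite dnormZ gtr0_norm ?subr_gt0 //.
have -> : 1 - t = r / (dnorm (edot E) y + 1 + r) by rewrite /t; field; rewrite gt_eqF.
rewrite mulrAC ltr_pdivrMr // ltr_pM2l //; lra.
Qed.

Lemma gauge_le1 x : gauge P x <= 1 <-> P x.
Proof. by rewrite gauge_le // invr1 scale1r. Qed.

Lemma gauge_is_norm : is_norm (gauge P).
Proof.
have [/convex_setE cP _ _] := body_convex B.
split=> [x y|a x|x x0].
- (* The normalised sum is a convex combination of the normalised summands; [e]
     keeps the normalising factors positive. *)
  apply/ler_addgt0Pr => e e0.
  have gx := gauge_ge0 P x; have gy := gauge_ge0 P y.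
  set p := gauge P x + e / 2; set q := gauge P y + e / 2.
  have p0 : 0 < p by rewrite /p; lra.
  have q0 : 0 < q by rewrite /q; lra.
  have -> : gauge P x + gauge P y + e = p + q by rewrite /p /q; lra.
  have pq0 : p + q != 0 by rewrite gt_eqF // addr_gt0.
  have Px : P (p^-1 *: x) by apply/gauge_le => //; rewrite /p; lra.
  have Py : P (q^-1 *: y) by apply/gauge_le => //; rewrite /q; lra.
  apply/gauge_le; first exact: addr_gt0.
  have := cP _ _ (p / (p + q)) _ _ Px Py.
  rewrite !scalerA.
  have -> : p / (p + q) * p^-1 = (p + q)^-1 by field; rewrite pq0 gt_eqF.
  have -> : (1 - p / (p + q)) * q^-1 = (p + q)^-1 by field; rewrite pq0 gt_eqF.
  rewrite -scalerDr; apply.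
    by rewrite divr_ge0 ?ltW // addr_gt0.
  by rewrite ler_pdivrMr; lra.
- have [->|a0] := eqVneq a 0.
    rewrite scale0r normr0 mul0r; apply: eq_le_pos; rewrite ?gauge_ge0 // => k k0.
    by rewrite gauge_le // scaler0; split=> _; [exact: ltW|exact: sym_body0].
  have na : 0 < `|a| by rewrite normr_gt0.
  apply: eq_le_pos; rewrite ?mulr_ge0 ?gauge_ge0 // => k k0.
  rewrite -ler_pdivlMl // gauge_le // gauge_le ?mulr_gt0 ?invr_gt0 //.
  rewrite invfM invrK scalerA.
  have na0 : `|a| != 0 by rewrite normr_eq0.
  split=> H.
    have -> : (`|a| / k) *: x = (`|a| / a) *: ((k^-1 * a) *: x).
      by rewrite scalerA; congr (_ *: _); field; rewrite a0 gt_eqF.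
    by apply: body_scale; rewrite // normrM normfV normr_id divff.
  have -> : (k^-1 * a) *: x = (a / `|a|) *: ((`|a| / k) *: x).
    by rewrite scalerA; congr (_ *: _); field; rewrite na0 gt_eqF.
  by apply: body_scale; rewrite // normrM normfV normr_id divff.
- have [C C0 PC] := sym_body_bounded B.
  apply: (@dnorm_eq0 _ _ (edot E)); apply/le_anti; rewrite dnorm_ge0 andbT.
  apply/ler_addgt0Pr => e e0; rewrite add0r.
  have eC : 0 < e / C by rewrite divr_gt0.
  have /PC : P ((e / C)^-1 *: x) by apply/gauge_le => //; rewrite x0 ltW.
  rewrite dnormZ normfV gtr0_norm // invf_div mulrAC ler_pdivrMr //.
  by rewrite ler_pM2l.
Qed.

(** The normed space whose unit ball is the body. *)
Definition gauge_banach : banach R := Banach gauge_is_norm.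
End Gauge.

(** * Bodies and unit balls *)

Section Extensionality.
Import Defs.
Variable R : realType.

Lemma sym_body_ext (E : euclidean R) (P Q : sym_body E) :
  P = Q :> set _ -> P = Q.
Proof.
case: P Q => [P cP sP] [Q cQ sQ] /= PQ; case: _ / PQ cQ sQ => cQ sQ.
by congr SymBody; exact: Prop_irrelevance.
Qed.

Lemma gauge_ball (M : banach R) (s : {dot M for idfun}) x :
  gauge (ball_body s) x = bnorm x.
Proof.
have [ND NZ N0] := bnormP M.
apply: eq_le_pos; rewrite ?gauge_ge0 //.
  exact: (@seminorm_ge0 _ (Euclidean s) _ ND NZ).
move=> k k0; rewrite gauge_le //= NZ gtr0_norm ?invr_gt0 //.
by rewrite ler_pdivrMl // mulr1.
Qed.
End Extensionality.

(** * Norms and operator norms *)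

Section Norms.
Import Defs.
Variable R : realType.

Lemma is_norm0 (V : vectType R) (N : V -> R) : is_norm N -> N 0 = 0.
Proof. by move=> [_ NZ _]; rewrite -(scale0r 0) NZ normr0 mul0r. Qed.

Lemma is_norm_ge0 (V : vectType R) (N : V -> R) x : is_norm N -> 0 <= N x.
Proof. by move=> [ND NZ _]; exact: (@seminorm_ge0 _ (Euclidean (std_dot V)) _ ND NZ). Qed.

(** By homogeneity a bound on the unit ball is a bound everywhere. *)
Lemma le_of_unit_ball (V : vectType R) (N N' : V -> R) (C : R) : is_norm N ->
  (forall a x, N' (a *: x) = `|a| * N' x) ->
  (forall x, N x <= 1 -> N' x <= C) -> forall x, N' x <= C * N x.
Proof.
move=> nN NZ' le1 x; have [_ NZ N0] := nN.
have [->|x0] := eqVneq x 0.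
  by rewrite -(scale0r 0) NZ NZ' normr0 !mul0r mulr0.
have Nx : 0 < N x.
  by rewrite lt0r is_norm_ge0 // andbT; apply: contra_neq x0 => /N0.
rewrite mulrC -ler_pdivrMl // -[X in X * _]gtr0_norm ?invr_gt0 // -NZ'.
by apply: le1; rewrite NZ gtr0_norm ?invr_gt0 // mulVf // gt_eqF.
Qed.

Lemma opnorm_le (V W : vectType R) (NV : V -> R) (NW : W -> R) (T : 'Hom(V, W)) C :
  is_norm NV -> (forall x, NV x <= 1 -> NW (T x) <= C) -> opnorm NV NW T <= C.
Proof.
move=> nV TC; apply: ge_sup; last by move=> _ [x x1 <-]; exact: TC.
by exists (NW (T 0)), 0 => //=; rewrite is_norm0.
Qed.

Lemma le_opnorm (V W : vectType R) (NV : V -> R) (NW : W -> R) (T : 'Hom(V, W)) x :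
  is_norm NV -> is_norm NW -> NW (T x) <= opnorm NV NW T * NV x.
Proof.
move=> nV nW; have [WD WZ _] := nW.
have TZ a y : NW (T (a *: y)) = `|a| * NW (T y) by rewrite linearZ WZ.
have [C C0 TC] := @banach_le _ (Banach nV) (fun x => NW (T x))
  (fun x y => eq_ind_r (fun z => NW z <= _) (WD _ _) (linearD T x y)) TZ.
apply: (le_of_unit_ball (N' := fun x => NW (T x))) => // y y1.
apply: ub_le_sup; last by exists y.
exists C => _ [z /= z1 <-]; rewrite (le_trans (TC z)) //.
by rewrite ler_piMr ?(ltW C0).
Qed.

Lemma opnorm_ge0 (V W : vectType R) (NV : V -> R) (NW : W -> R) (T : 'Hom(V, W)) :
  is_norm NV -> is_norm NW -> 0 <= opnorm NV NW T.
Proof.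
move=> nV nW; rewrite /opnorm; set S := [set NW (T x) | x in _].
have [hS|/sup_out->//] := pselect (has_sup S).
apply: (ub_le_sup hS.2); exists 0; first by rewrite /= is_norm0.
by rewrite linear0 is_norm0.
Qed.
End Norms.

(** * Half-spaces *)

Section Halfspace.
Import Defs.

Lemma convex_halfspace (R : realType) (V : vectType R) (s : {dot V for idfun}) (y : V) :
  convex_set [set x | s x y <= 1].
Proof.
apply/convex_setE => v w t t0 t1 /= v1 w1; rewrite dotDl !dotZl.
apply: (@le_trans _ _ (t * 1 + (1 - t) * 1)); last by lra.
by rewrite lerD // ler_wpM2l ?subr_ge0.
Qed.
End Halfspace.

(** * Tensor products of linear maps *)

Section Tensors.
Variables (R : realType) (l : nat).
Implicit Types V W U : 'I_l -> vectType R.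

Lemma eq_Hom_tensor V (U : vectType R) (S T : 'Hom(tensor V, U)) :
  (forall x, S (tprod x) = T (tprod x)) -> S = T.
Proof. by move=> ST; apply/lfunP; exact: eq_linear_tensor. Qed.

Lemma tmap_id V : tmap (fun i => \1%VF : 'Hom(V i, V i)) = \1%VF.
Proof.
apply: eq_Hom_tensor => x; rewrite tmap_tprod id_lfunE; congr tprod.
by apply: functional_extensionality_dep => i; rewrite id_lfunE.
Qed.

Lemma tmap_comp V W U (S : forall i, 'Hom(W i, U i)) (T : forall i, 'Hom(V i, W i)) :
  tmap (fun i => (S i \o T i)%VF) = (tmap S \o tmap T)%VF.
Proof.
apply: eq_Hom_tensor => x; rewrite comp_lfunE !tmap_tprod; congr tprod.
by apply: functional_extensionality_dep => i; rewrite comp_lfunE.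
Qed.

Lemma tmap_cancel V W (S : forall i, 'Hom(W i, V i)) (T : forall i, 'Hom(V i, W i)) :
  (forall i, cancel (T i) (S i)) -> cancel (tmap T) (tmap S).
Proof.
move=> TK u; rewrite -comp_lfunE -tmap_comp -[RHS](id_lfunE u) -tmap_id.
congr (tmap _ u); apply: functional_extensionality_dep => i; apply/lfunP => x.
by rewrite comp_lfunE id_lfunE TK.
Qed.

Lemma tprodZ V (c : 'I_l -> R) (x : forall i, V i) :
  tprod (fun i => c i *: x i) = (\prod_i c i) *: tprod x.
Proof.
apply/ffunP => j; rewrite !ffunE /GRing.scale /= -big_split; apply: eq_bigr => i _ /=.
exact: linearZ.
Qed.

Lemma tmapZ V W (c : 'I_l -> R) (T : forall i, 'Hom(V i, W i)) :
  tmap (fun i => c i *: T i) = (\prod_i c i) *: tmap T.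
Proof.
apply: eq_Hom_tensor => x; rewrite scale_lfunE !tmap_tprod -tprodZ; congr tprod.
by apply: functional_extensionality_dep => i; rewrite scale_lfunE.
Qed.

(** Some factor must absorb the coefficients of the expansion in the product basis,
    which is why the order of the tensor product has to be positive. *)
Lemma tprod_decomposition V (u : tensor V) : (0 < l)%N ->
  exists n (x : 'I_n -> forall i, V i), u = \sum_j tprod (x j).
Proof.
move=> l0; pose i0 := Ordinal l0.
pose x (j : tensor_index V) i := (if i == i0 then u j else 1) *: stdbasis (j i).
exists #|tensor_index V|, (fun k => x (enum_val k)).
rewrite -(big_enum_val (fun j => tprod (x j))).
rewrite [LHS]tensorE; apply: eq_big => // j _.
rewrite /x (tprodZ (fun i => if i == i0 then u j else 1)); congr (_ *: _).
by rewrite (bigD1 i0) //= big1 ?mulr1 // => i /negbTE ->.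
Qed.
End Tensors.

(** * Riesz representation *)

Section Riesz.
Import Defs.
Variables (R : realType) (V : vectType R) (s : {dot V for idfun}).

(** The scalar product as a function of its first argument, so that [riesz y] is
    the functional represented by [y]. *)
Definition dot_right (y x : V) : R^o := s x y.

Fact dot_right_is_linear y : linear (dot_right y).
Proof. by move=> a x z; exact: dotP. Qed.
HB.instance Definition _ y :=
  GRing.isLinear.Build R V R^o *:%R (dot_right y) (dot_right_is_linear y).

Definition dot_functional y : 'Hom(V, R^o) := linfun (dot_right y).

Fact dot_functional_is_linear : linear dot_functional.
Proof.
move=> a y z; apply/lfunP => x.
by rewrite add_lfunE scale_lfunE !lfunE /= /dot_right dotDr dotZr.
Qed.
HB.instance Definition _ :=
  GRing.isLinear.Build R V 'Hom(V, R^o) *:%R dot_functional dot_functional_is_linear.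

Definition riesz : 'Hom(V, 'Hom(V, R^o)) := linfun dot_functional.

Lemma rieszE y x : riesz y x = s x y.
Proof. by rewrite lfunE /= lfunE. Qed.

Lemma rieszK : cancel riesz (riesz^-1)%VF.
Proof.
apply: lker0_lfunK; apply/lker0P => y z yz; apply/eqP; rewrite -subr_eq0.
have r0 : riesz (y - z) = 0 by rewrite linearB /= yz subrr.
by apply/eqP/(@dot_eq0 _ _ s); rewrite -rieszE r0 lfunE.
Qed.

(** The representing vector of a functional is read off an orthonormal basis. *)
Lemma riesz_inv : cancel (riesz^-1)%VF riesz.
Proof.
move=> f; apply: limg_lfunVK.
have [e [oe eE]] := ex_orthonormal_basis s.
suff -> : f = riesz (\sum_k f (e k) *: e k) by exact: memv_img (memvf _).
apply/lfunP => x; rewrite rieszE [in LHS](eE x) linear_sum dot_sumr.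
by apply: eq_bigr => k _; rewrite linearZ dotZr mulrC.
Qed.
End Riesz.

(** * From bodies to norms *)

Section Correspondence.
Import Defs.
Variables (R : realType) (l : nat).
Implicit Types (E : 'I_l -> euclidean R) (M N : 'I_l -> banach R).
Implicit Types (a : body_tensor_product R l).

(** The body depends only on the sets P_i and not on the scalar products: the
    identity maps satisfy the uniform property in both directions. *)
Lemma btprod_change_dot a E (s : forall i, {dot E i for idfun})
    (P : forall i, sym_body (E i)) (Q : forall i, sym_body (Euclidean (s i))) :
  (forall i, body_set (P i) = body_set (Q i)) ->
  body_set (a E P) = body_set (a (fun i => Euclidean (s i)) Q).
Proof.
move=> PQ.
have im_id (V : vectType R) (A : set V) : (\1%VF : 'Hom(V, V)) @` A = A.
  by apply/seteqP; split=> [_ [x Ax <-]|x Ax]; [|exists x]; rewrite ?id_lfunE.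
apply/seteqP; split.
- have /= := @btprod_uniform _ _ a E (fun i => Euclidean (s i)) (fun i => \1%VF) P Q.
  by rewrite tmap_id im_id; apply => i; rewrite im_id PQ.
- have /= := @btprod_uniform _ _ a (fun i => Euclidean (s i)) E (fun i => \1%VF) Q P.
  by rewrite tmap_id im_id; apply => i; rewrite im_id PQ.
Qed.

Definition body_norm a M : tensor M -> R :=
  gauge (a (fun i => Euclidean (std_dot (M i))) (fun i => ball_body (std_dot (M i)))).

Lemma body_normE a M (s : forall i, {dot M i for idfun}) (z : tensor M) :
  body_norm a z = gauge (a (fun i => Euclidean (s i)) (fun i => ball_body (s i))) z.
Proof.
by congr (gauge _ z); exact: (@btprod_change_dot a (fun i => Euclidean (std_dot (M i))) s).
Qed.

Lemma body_norm_le1 a M (s : forall i, {dot M i for idfun}) (z : tensor M) :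
  body_norm a z <= 1 <-> body_set (a (fun i => Euclidean (s i)) (fun i => ball_body (s i))) z.
Proof. by rewrite (body_normE a s) gauge_le1. Qed.

(** A tensor product of bodies can be recovered from its norm. *)
Lemma body_norm_gauge a E (P : forall i, sym_body (E i)) (u : tensor E) :
  body_norm a (M := fun i => gauge_banach (P i)) u <= 1 <-> body_set (a E P) u.
Proof.
rewrite (body_norm_le1 (M := fun i => gauge_banach (P i)) a (fun i => edot (E i))).
rewrite -(@btprod_change_dot a E (fun i => edot (E i)) P) // => i.
by apply/seteqP; split=> x /gauge_le1.
Qed.

Lemma body_norm_is_norm a M : is_norm (@body_norm a M).
Proof. exact: (gauge_is_norm (a _ (fun i => ball_body (std_dot (M i))))). Qed.

Lemma eps_norm_le M (u : tensor M) C :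
  (forall f, (forall i, dual_norm (f i) <= 1) -> `|tfunctional f u| <= C) ->
  eps_norm u <= C.
Proof.
move=> fC; apply: ge_sup; last by move=> _ [f f1 <-]; exact: fC.
exists `|tfunctional (fun i => 0 : 'Hom(M i, R^o)) u|, (fun i => 0) => //= i.
by rewrite (is_norm0 (dual_norm_is_norm (M i))).
Qed.

Lemma le_dual_norm (X : banach R) (f : 'Hom(X, R^o)) x : `|f x| <= dual_norm f * bnorm x.
Proof.
apply: (le_of_unit_ball (N' := fun x => `|f x|)) (bnormP X) _ _ x => [b x|x].
  by rewrite linearZ normrM.
exact: dual_norm_ub.
Qed.

(** The supremum in the injective norm is over a bounded set, since a tensor has a
    finite expansion in the product basis. *)
Lemma eps_norm_ub M (u : tensor M) f :
  (forall i, dual_norm (f i) <= 1) -> `|tfunctional f u| <= eps_norm u.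
Proof.
move=> f1; apply: ub_le_sup; last by exists f.
exists (\sum_(j : tensor_index M) `|u j| * \prod_i bnorm (stdbasis (j i) : M i)).
move=> _ [g g1 <-]; apply: le_trans (ler_norm_sum _ _ _) _.
apply: ler_sum => j _; rewrite normrM ler_wpM2l // normr_prod.
apply: ler_prod => i _; rewrite normr_ge0 (le_trans (le_dual_norm _ _)) //.
by rewrite ler_piMl ?g1 //; exact: is_norm_ge0 (bnormP (M i)).
Qed.

(** The product of functionals represented by the y_i is represented by their
    elementary tensor; both sides agree on elementary tensors. *)
Lemma tfunctional_riesz (V : 'I_l -> vectType R) (s : forall i, {dot V i for idfun})
    (y : forall i, V i) (u : tensor V) :
  tfunctional (fun i => riesz (s i) (y i)) u = tensor_dot s (tprod y) u.
Proof.
rewrite dotC; move: u.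
apply: (@eq_linear_tensor _ _ V R^o (tlift _) (dot_right (tensor_dot s) (tprod y))) => x.
transitivity (\prod_i riesz (s i) (y i) (x i)); first exact: tfunctional_tprod.
rewrite [RHS]tensor_dot_tprod.
by apply: eq_bigr => i _; rewrite rieszE.
Qed.

(** The Riesz map identifies the polar of the unit ball with the dual unit ball. *)
Lemma dual_norm_riesz (X : banach R) (s : {dot X for idfun}) (y : X) :
  dual_norm (riesz s y) <= 1 <-> polar (ball_body s) y.
Proof.
split=> [y1|/polarP Py].
  apply/polarP => x x1; rewrite /= -rieszE.
  by apply: le_trans (ler_norm _) _; apply: le_trans y1; exact: dual_norm_ub.
apply: dual_norm_le => x x1; rewrite rieszE ler_norml.
rewrite (Py _ x1) andbT.
have := Py (- x); rewrite /= -scaleN1r dotZl; have [_ NZ _] := bnormP X.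
by rewrite NZ normrN1 mul1r => /(_ x1); lra.
Qed.

(** Functionals of dual norm at most 1 are represented by points of the polars, so
    their product is one of the functionals that cut out the injective body. *)
Lemma body_norm_eps a M (u : tensor M) : eps_norm u <= body_norm a u.
Proof.
apply: eps_norm_le => f f1; rewrite -[leRHS]mul1r.
have fZ b v : `|tfunctional f (b *: v)| = `|b| * `|tfunctional f v|.
  by rewrite /tfunctional linearZ normrM.
apply: (le_of_unit_ball (body_norm_is_norm a M) fZ) => v.
pose s i := std_dot (M i); rewrite (body_norm_le1 a s) => av.
pose y i := ((riesz (s i))^-1)%VF (f i).
have fy : f = fun i => riesz (s i) (y i).
  by apply: functional_extensionality_dep => i; rewrite riesz_inv.
have Py : pi_prod (fun i => polar (ball_body (s i))) (tprod y).
  apply: sub_gen_smallest; exists y => // i; apply/dual_norm_riesz.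
  by rewrite riesz_inv.
have le1 w : body_set (a (fun i => Euclidean (s i)) (fun i => ball_body (s i))) w ->
    tfunctional f w <= 1.
  by move=> /btprod_eps/polarP/(_ _ Py); rewrite fy tfunctional_riesz.
rewrite ler_norml le1 // andbT.
have /zero_symmetricP/(_ _ av)/le1 :=
  body_sym (a (fun i => Euclidean (s i)) (fun i => ball_body (s i))).
by rewrite /tfunctional linearN; lra.
Qed.

(** An elementary tensor of unit vectors is in the projective body; the general case
    follows by normalising the factors, unless one of them is 0. *)
Lemma body_norm_tprod a M (hl : (0 < l)%N) (x : forall i, M i) :
  body_norm a (tprod x) <= \prod_i bnorm (x i).
Proof.
have [_ NZ _] := body_norm_is_norm a M.
have [x0|x0] := pselect (forall i, bnorm (x i) != 0).
  pose y i := (bnorm (x i))^-1 *: x i.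
  have -> : x = fun i => bnorm (x i) *: y i.
    by apply: functional_extensionality_dep => i; rewrite scalerA mulfV ?scale1r.
  rewrite tprodZ NZ ger0_norm; last first.
    by apply: prodr_ge0 => i _; exact: is_norm_ge0 (bnormP (M i)).
  set c := \prod_i bnorm (x i).
  suff -> : \prod_i bnorm (bnorm (x i) *: y i) = c.
    rewrite ler_piMr ?prodr_ge0 // => [i _|]; first exact: is_norm_ge0 (bnormP (M i)).
    apply/(body_norm_le1 a (fun i => std_dot (M i)))/btprod_pi.
    apply: sub_gen_smallest; exists y => // i /=.
    have [_ -> _] := bnormP (M i).
    by rewrite ger0_norm ?mulVf // invr_ge0 (is_norm_ge0 _ (bnormP (M i))).
  by apply: eq_bigr => i _; rewrite scalerA mulfV ?scale1r.
have [i] : exists i, ~ (bnorm (x i) != 0).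
  by apply/not_existsP => H; apply: x0 => i; apply: contrapT.
move=> /negP; rewrite negbK => /eqP xi0.
have [_ _ N0] := bnormP (M i).
have -> : tprod x = 0.
  apply/ffunP => j; rewrite !ffunE (bigD1 i) //= (N0 _ xi0) /stdcoord linear0.
  by rewrite mul0r.
rewrite is_norm0 //; last exact: body_norm_is_norm.
by apply: prodr_ge0 => k _; exact: is_norm_ge0 (bnormP (M k)).
Qed.

Lemma body_norm_pi a M (hl : (0 < l)%N) (u : tensor M) : body_norm a u <= pi_norm u.
Proof.
have [ND _ _] := body_norm_is_norm a M.
apply: lb_le_inf.
  have [n [x ux]] := tprod_decomposition u hl.
  by exists (\sum_j \prod_i bnorm (x j i)), n, x.
move=> _ [n [x [-> ->]]].
elim/big_ind2 : _ => [|v b w c vb wc|j _].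
- by rewrite is_norm0 //; exact: body_norm_is_norm.
- by rewrite (le_trans (ND _ _)) // lerD.
- exact: body_norm_tprod.
Qed.

(** Dividing each T_i by its operator norm gives maps between unit balls, to which
    the uniform property applies. If some operator norm is 0, then the tensor
    product of the maps vanishes as well. *)
Lemma body_norm_map a M N (T : forall i, 'Hom(M i, N i)) :
  opnorm (@body_norm a M) (@body_norm a N) (tmap T) <=
  \prod_i opnorm (@bnorm _ (M i)) (@bnorm _ (N i)) (T i).
Proof.
apply: opnorm_le; first exact: body_norm_is_norm.
have [_ NZ _] := body_norm_is_norm a N.
move=> u u1; set t := fun i => opnorm (@bnorm _ (M i)) (@bnorm _ (N i)) (T i).
have Tt i x : bnorm (T i x) <= t i * bnorm x.
  exact: le_opnorm (bnormP _) (bnormP _).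
have t0 i : 0 <= t i.
  exact: opnorm_ge0 (bnormP _) (bnormP _).
rewrite -/(\prod_i t i).
have [tn0|tn0] := pselect (forall i, t i != 0).
  pose S i := (t i)^-1 *: T i.
  have -> : T = fun i => t i *: S i.
    by apply: functional_extensionality_dep => i; rewrite scalerA mulfV ?scale1r.
  rewrite tmapZ scale_lfunE NZ ger0_norm ?prodr_ge0 //.
  rewrite ler_piMr ?prodr_ge0 //.
  pose s i := std_dot (M i); pose r i := std_dot (N i).
  apply/(body_norm_le1 a r); move/(body_norm_le1 a s): u1 => u1.
  apply: (@btprod_uniform _ _ a (fun i => Euclidean (s i)) (fun i => Euclidean (r i)) S
    (fun i => ball_body (s i)) (fun i => ball_body (r i))); last by exists u.
  move=> i _ [x /= x1 <-]; rewrite scale_lfunE; have [_ -> _] := bnormP (N i).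
  rewrite ger0_norm ?invr_ge0 // ler_pdivrMl ?lt0r ?tn0 ?t0 // mulr1.
  by rewrite (le_trans (Tt _ _)) // ler_piMr.
have [i] : exists i, ~ (t i != 0) by apply/not_existsP => H; apply: tn0 => i; apply: contrapT.
move=> /negP; rewrite negbK => /eqP ti0.
have -> : tmap T = 0.
  apply: eq_Hom_tensor => x; rewrite tmap_tprod lfunE; apply/ffunP => j.
  rewrite !ffunE (bigD1 i) //=.
  have -> : T i (x i) = 0.
    have [_ _ N0] := bnormP (N i); apply: N0; apply/le_anti.
    by rewrite (is_norm_ge0 _ (bnormP (N i))) andbT (le_trans (Tt _ _)) // ti0 mul0r.
  by rewrite /stdcoord linear0 mul0r.
rewrite lfunE (is_norm0 (body_norm_is_norm a N)).
exact: prodr_ge0.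
Qed.
End Correspondence.

(** * From norms to bodies *)

Section Inverse.
Import Defs.
Variables (R : realType) (l : nat).
Implicit Types (E F : 'I_l -> euclidean R) (M N : 'I_l -> banach R).
Implicit Types (a b : body_tensor_product R l) (n : tensor_norm R l).

Definition norm_of_product (hl : (0 < l)%N) a : tensor_norm R l :=
  TensorNorm (@body_norm_is_norm _ _ a) (@body_norm_eps _ _ a)
    (fun M => @body_norm_pi _ _ a M hl) (@body_norm_map _ _ a).

(** The unit ball of the tensor norm, formed on the factors normed by the gauges of
    the P_i. *)
Definition norm_body n E (P : forall i, sym_body (E i)) : sym_body (tensor_euclidean E) :=
  @ball_body R (Banach (@tnorm_norm _ _ n (fun i => gauge_banach (P i))))
    (tensor_dot (fun i => edot (E i))).

(** The projective norm of x^1 (x) ... (x) x^l is at most 1 for x^i in P_i, and the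
    unit ball is convex. *)
Lemma norm_body_pi n E (P : forall i, sym_body (E i)) :
  pi_prod P `<=` norm_body n P.
Proof.
have [cP _ _] := body_convex (norm_body n P).
apply: smallest_sub => // _ [x Px <-] /=.
apply: le_trans (tnorm_pi _ _) _.
have gx i := (gauge_le1 (P i) (x i)).2 (Px i).
apply: le_trans (_ : \sum_(j < 1) \prod_i gauge (P i) (x i) <= _).
  apply: ge_inf; last by exists 1, (fun _ => x); rewrite !big_ord1.
  exists 0 => _ [k [y [_ ->]]]; apply: sumr_ge0 => j _; apply: prodr_ge0 => i _.
  exact: gauge_ge0.
by rewrite big_ord1 prodr_ile1 // => i _; rewrite gauge_ge0 gx.
Qed.

(** A point of the projective body of the polars is in the convex hull of the
    representatives of products of functionals of dual norm at most 1, on which the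
    injective norm, hence also the tensor norm, gives the bound 1. *)
Lemma norm_body_eps n E (P : forall i, sym_body (E i)) :
  norm_body n P `<=` eps_prod P.
Proof.
move=> u /= u1; apply/polarP.
pose M i := gauge_banach (P i).
suff : pi_prod (fun i => polar (P i)) `<=`
    [set v : tensor E | tensor_dot (fun i => edot (E i)) v u <= 1] by [].
apply: smallest_sub; first exact: convex_halfspace.
move=> _ [y Py <-].
change (tensor_dot (fun i => edot (E i)) (tprod y) u <= 1).
rewrite -tfunctional_riesz; apply: le_trans (ler_norm _) _.
apply: le_trans (le_trans (tnorm_eps n (M := M) u) u1).
have riesz1 i : @dual_norm _ (M i) (riesz (edot (E i)) (y i)) <= 1.
  apply/(@dual_norm_riesz _ (M i) (edot (E i)))/polarP => x /gauge_le1.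
  by move: (Py i) => /polarP; apply.
exact: (eps_norm_ub (M := M)).
Qed.

Lemma opnorm_map_le1 n M N (T : forall i, 'Hom(M i, N i)) :
  (forall i x, bnorm x <= 1 -> bnorm (T i x) <= 1) ->
  forall u, n M u <= 1 -> n N (tmap T u) <= 1.
Proof.
move=> T1 u u1.
apply: le_trans (le_opnorm _ _ (tnorm_norm n M) (tnorm_norm n N)) _.
have op0 := opnorm_ge0 (tmap T) (tnorm_norm n M) (tnorm_norm n N).
apply: le_trans (ler_piMr op0 u1) _; apply: le_trans (tnorm_map _ _) _.
rewrite prodr_ile1 // => i _; rewrite opnorm_ge0 //=; try exact: bnormP.
by apply: opnorm_le; [exact: bnormP|exact: T1].
Qed.

Lemma norm_body_uniform n E F (T : forall i, 'Hom(E i, F i))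
    (P : forall i, sym_body (E i)) (Q : forall i, sym_body (F i)) :
  (forall i, T i @` P i `<=` Q i) -> tmap T @` norm_body n P `<=` norm_body n Q.
Proof.
move=> TPQ _ [u u1 <-] /=.
apply: (@opnorm_map_le1 n (fun i => gauge_banach (P i)) (fun i => gauge_banach (Q i)) T) => //.
by move=> i x /gauge_le1 Px; apply/gauge_le1/TPQ; exists x.
Qed.

Definition product_of_norm n : body_tensor_product R l :=
  BodyTensorProduct (@norm_body_pi n) (@norm_body_eps n) (@norm_body_uniform n).

Lemma norm_of_productK (hl : (0 < l)%N) : cancel (norm_of_product hl) product_of_norm.
Proof.
move=> a.
have E : btprod (product_of_norm (norm_of_product hl a)) = btprod a.
  apply: functional_extensionality_dep => E; apply: functional_extensionality_dep => P.
  apply: sym_body_ext; apply/seteqP; split=> u /=; first by move/body_norm_gauge.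
  by move=> au; apply/body_norm_gauge.
case: a (product_of_norm _) E => [a api aeps aun] [b bpi beps bun] /= E.
by case: _ / E aeps api aun => *; congr BodyTensorProduct; exact: Prop_irrelevance.
Qed.

Lemma product_of_normK (hl : (0 < l)%N) : cancel product_of_norm (norm_of_product hl).
Proof.
move=> n.
have E : tnorm (norm_of_product hl (product_of_norm n)) = tnorm n.
  apply: functional_extensionality_dep => M; apply/funext => u.
  transitivity (n (fun i => gauge_banach (ball_body (std_dot (M i)))) u).
    exact: (gauge_ball (M := Banach (tnorm_norm n
      (fun i => gauge_banach (ball_body (std_dot (M i))))))).
  (* Each M i equals the Banach space normed by the gauge of its ball, but only
     propositionally; [H] transports the norm along equal norms on a fixed carrier,
     so that the type of [u] does not change. *)
  move: M u; suff H (V : 'I_l -> vectType R) (N N' : forall i, V i -> R)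
      (nN : forall i, is_norm (N i))
      (nN' : forall i, is_norm (N' i)) (u : tensor V) : (forall i, N i =1 N' i) ->
      n (fun i => Banach (nN i)) u = n (fun i => Banach (nN' i)) u.
    move=> M; have <- : (fun i => Banach (bnormP (M i))) = M.
      by apply: functional_extensionality_dep => i; case: (M i).
    by move=> u; apply: H => i x /=; rewrite gauge_ball.
  move=> NN'; have {}NN' : N = N'.
    by apply: functional_extensionality_dep => i; apply/funext => x; exact: NN'.
  by case: _ / NN' nN' => nN'; rewrite (Prop_irrelevance nN nN').
case: n (norm_of_product _ _) E => [n n1 n2 n3 n4] [m m1 m2 m3 m4] /= E.
by case: _ / E n1 n2 n3 n4 => *; congr TensorNorm; exact: Prop_irrelevance.
Qed.
End Inverse.

(** * Duality *)

Section Duality.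
Import Defs.
Variables (R : realType).

(** A bound on the absolute values of v |-> <v, u> over Q is a bound on the values,
    because Q is symmetric. *)
Lemma gauge_polar (E : euclidean R) (Q : sym_body E) u :
  gauge (polar Q) u = sup [set `|edot E v u| | v in body_set Q].
Proof.
have Q0 : [set `|edot E v u| | v in body_set Q] !=set0.
  by exists `|edot E 0 u|, 0 => //; exact: sym_body0.
have Qs : has_sup [set `|edot E v u| | v in body_set Q].
  split => //; have [C C0 QC] := sym_body_bounded Q.
  exists (C * dnorm (edot E) u) => _ [v Qv <-].
  by rewrite (le_trans (dot_CauchySchwarz _ _ _)) // ler_wpM2r ?dnorm_ge0 ?QC.
apply: eq_le_pos; first exact: gauge_ge0.
  case: Q0 => x [v Qv vx]; apply: (@le_trans _ _ x); first by rewrite -vx.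
  by apply: ub_le_sup; [exact: Qs.2|exists v].
move=> k k0; rewrite (gauge_le (polar_body Q)) //; split=> [/polarP Qu|Qk].
  apply: ge_sup => // _ [v Qv <-].
  have le v' : body_set Q v' -> edot E v' u <= k.
    by move=> /Qu; rewrite dotZr ler_pdivrMl // mulr1.
  rewrite ler_norml le // andbT.
  have /zero_symmetricP/(_ _ Qv)/le := body_sym Q.
  by rewrite -scaleN1r dotZl; lra.
apply/polarP => v Qv; rewrite dotZr ler_pdivrMl // mulr1.
apply: le_trans (ler_norm _) _; apply: le_trans Qk.
by apply: ub_le_sup; [exact: Qs.2|exists v].
Qed.

Variable l : nat.
Implicit Types (E F : 'I_l -> euclidean R) (M N : 'I_l -> banach R).
Implicit Types (a b : body_tensor_product R l).

(** Both sides are linear in [v] and agree on elementary tensors. *)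
Lemma tpairing_riesz (V : 'I_l -> vectType R) (s : forall i, {dot V i for idfun})
    (v u : tensor V) :
  tpairing (tmap (fun i => riesz (s i)) v) u = tensor_dot s v u.
Proof.
move: v; apply: (@eq_linear_tensor _ _ V R^o
  (tlift (fun f => tfunctional f u) \o tmap (fun i => riesz (s i)))
  (dot_right (tensor_dot s) u)) => y.
transitivity (tpairing (tmap (fun i => riesz (s i)) (tprod y)) u); first by [].
rewrite tmap_tprod; apply: etrans (tpairing_tprod _ _) _.
exact: tfunctional_riesz.
Qed.

(** The Riesz maps and their inverses exchange the polars of the unit balls and the
    dual unit balls, so the uniform property applies in both directions. *)
Lemma body_norm_riesz a M (s : forall i, {dot M i for idfun}) (v : tensor M) :
  body_norm a (M := fun i => dual_banach (M i)) (tmap (fun i => riesz (s i)) v) <= 1 <->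
  body_set (a (fun i => Euclidean (s i)) (fun i => polar_body (ball_body (s i)))) v.
Proof.
pose r i := std_dot (dual_banach (M i)).
rewrite (body_norm_le1 (M := fun i => dual_banach (M i)) a r).
split=> av.
  rewrite -(tmap_cancel (fun i => @rieszK _ _ (s i)) v).
  apply: (@btprod_uniform _ _ a (fun i => Euclidean (r i)) (fun i => Euclidean (s i))
    (fun i => (riesz (s i))^-1%VF) (fun i => ball_body (r i))
    (fun i => polar_body (ball_body (s i)))); last by eexists; [exact: av|].
  by move=> i _ [f /= f1 <-]; apply/dual_norm_riesz; rewrite riesz_inv.
apply: (@btprod_uniform _ _ a (fun i => Euclidean (s i)) (fun i => Euclidean (r i))
  (fun i => riesz (s i)) (fun i => polar_body (ball_body (s i)))
  (fun i => ball_body (r i))); last by exists v.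
by move=> i _ [y Py <-]; apply/dual_norm_riesz.
Qed.

(** The dual tensor norm is the gauge of the polar: the tensor product of the Riesz
    maps matches the functionals in the supremum with the points of the body. *)
Lemma dual_body_norm a M (s : forall i, {dot M i for idfun}) (u : tensor M) :
  sup [set `|tpairing phi u| | phi in
    [set phi | body_norm a (M := fun i => dual_banach (M i)) phi <= 1]] =
  gauge (polar (a (fun i => Euclidean (s i)) (fun i => polar_body (ball_body (s i))))) u.
Proof.
rewrite gauge_polar; congr sup; apply/seteqP; split=> _ [phi aphi <-].
  pose v := tmap (fun i => (riesz (s i))^-1%VF) phi.
  have vphi : tmap (fun i => riesz (s i)) v = phi.
    by apply: (tmap_cancel (T := fun i => (riesz (s i))^-1%VF)) => i; exact: riesz_inv.
  exists v; first by apply/body_norm_riesz; rewrite vphi.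
  by rewrite -vphi tpairing_riesz.
exists (tmap (fun i => riesz (s i)) phi); first exact/body_norm_riesz.
by rewrite tpairing_riesz.
Qed.

Lemma is_dual_body_norm (hl : (0 < l)%N) a b :
  is_dual_product a b <-> is_dual_norm (norm_of_product hl a) (norm_of_product hl b).
Proof.
split=> [ab M u|ab E P].
  pose s i := std_dot (M i).
  apply: esym; apply: etrans (dual_body_norm a s u) _.
  by rewrite -ab.
apply/seteqP.
pose M i := gauge_banach (P i).
have PE : polar (a E (fun i => polar_body (P i))) =
  polar (a (fun i => Euclidean (edot (E i)))
    (fun i => polar_body (@ball_body _ (M i) (edot (E i))))).
  congr (polar (E := tensor_euclidean E) _).
  apply: (@btprod_change_dot _ _ a E (fun i => edot (E i))) => i.
  apply: (congr1 (polar (E := E i))).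
  by apply/seteqP; split=> x /gauge_le1.
rewrite PE; set Q := a _ _.
have bE u : body_set (b E P) u <-> polar Q u.
  apply: iff_trans (iff_sym (body_norm_gauge b P u)) _.
  apply: iff_trans _ (gauge_le1 (polar_body Q) u).
  have /= -> := ab M u.
  by rewrite (@dual_body_norm a M (fun i => edot (E i))).
by split=> u /bE.
Qed.
End Duality.

(** * Injectivity *)

Section Injectivity.
Import Defs.
Variables (R : realType) (l : nat) (hl : (0 < l)%N).
Implicit Types (E F : 'I_l -> euclidean R) (M N : 'I_l -> banach R).
Implicit Types (a b : body_tensor_product R l).

(** The tensor product of linear projections is a left inverse. *)
Lemma tmap_incl_inj (V : 'I_l -> vectType R) (W : forall i, {vspace V i}) :
  injective (tmap (fun i => incl (W i))).
Proof.
apply: (can_inj (g := tmap (fun i => linfun (vsproj (W i))))).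
by apply: tmap_cancel => i x; rewrite lfunE /= lfunE /= vsvalK.
Qed.

(** Injectivity of the norm and of the body both compare, for tensors of the
    subspaces, membership in the unit ball with that of the image; for norms this
    suffices by homogeneity. Only the passage from the body equation to the
    comparison uses that the embedding is injective. *)
Lemma injective_body_norm a :
  injective_product a <-> injective_norm (norm_of_product hl a).
Proof.
split=> [ia M W u|ia E P W].
  pose s i := std_dot (M i).
  have [_ NZ _] := body_norm_is_norm a M.
  have nW := body_norm_is_norm a (fun i => sub_banach (W i)).
  have [_ WZ _] := nW.
  have subE v : body_norm a (M := fun i => sub_banach (W i)) v <= 1 <->
      body_norm a (tmap (fun i => incl (W i)) v) <= 1.
    rewrite (body_norm_le1 a s).
    pose r i := edot (@sub_euclidean _ (Euclidean (s i)) (W i)).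
    rewrite (body_norm_le1 (M := fun i => sub_banach (W i)) a r).
    have := ia (fun i => Euclidean (s i)) (fun i => ball_body (s i)) W.
    have -> : body_set (a (fun i => sub_euclidean (E := Euclidean (s i)) (W i))
          (fun i => @sub_body _ (Euclidean (s i)) (W i) (ball_body (s i)))) =
        body_set (a (fun i => Euclidean (r i))
          (fun i => @ball_body _ (sub_banach (W i)) (r i))).
      exact: (@btprod_change_dot _ _ a (fun i => sub_euclidean (E := Euclidean (s i)) (W i)) r).
    move=> /seteqP[sub1 sub2]; split=> [av|av].
      by have [] := sub1 (tmap (fun i => incl (W i)) v); first by exists v.
    by have [|w aw /tmap_incl_inj <-] := sub2 (tmap (fun i => incl (W i)) v).
  apply: eq_le_pos; [exact: is_norm_ge0 (body_norm_is_norm a M)|exact: is_norm_ge0 nW|].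
  move=> k k0; rewrite -[k]mulr1 -!ler_pdivrMl //=.
  have ki : k^-1 = `|k^-1| by rewrite gtr0_norm ?invr_gt0.
  by rewrite {1 2}ki -NZ -WZ subE linearZ.
apply/seteqP; pose M i := gauge_banach (P i).
have subE v : body_set (a _ (fun i => sub_body (W i) (P i))) v <->
    body_set (a E P) (tmap (fun i => incl (W i)) v).
  rewrite -(body_norm_gauge a P).
  have /= -> := ia M W v.
  pose r i := edot (sub_euclidean (E := E i) (W i)).
  rewrite (body_norm_le1 (M := fun i => sub_banach (M := M i) (W i)) a r).
  have -> // : body_set (a (fun i => sub_euclidean (E := E i) (W i))
          (fun i => sub_body (W i) (P i))) =
        body_set (a (fun i => Euclidean (r i))
          (fun i => @ball_body _ (sub_banach (M := M i) (W i)) (r i))).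
  apply: (@btprod_change_dot _ _ a (fun i => sub_euclidean (E := E i) (W i)) r) => i.
  by apply/seteqP; split=> x /gauge_le1.
split=> [_ [v /subE av <-]|u [au [v _ vu]]]; first by split=> //; exists v.
by exists v => //; apply/subE; rewrite vu.
Qed.
End Injectivity.


(** * Projectivity *)

Section Projectivity.
Import Defs.
Variables (R : realType) (l : nat) (hl : (0 < l)%N).
Implicit Types (E F : 'I_l -> euclidean R) (M N : 'I_l -> banach R).
Implicit Types (a b : body_tensor_product R l).

(** Each vector has a positive multiple in the open unit ball. *)
Lemma quotient_operator_limg (V W : vectType R) (NV : V -> R) (NW : W -> R) (T : 'Hom(V, W)) :
  is_norm NW -> quotient_operator NV NW T -> limg T = fullv.
Proof.
move=> nW qT; have [_ WZ _] := nW.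
apply/vspaceP => y; rewrite memvf.
have k0 : 0 < NW y + 1 by rewrite ltr_wpDl // is_norm_ge0.
have : [set y | NW y < 1] ((NW y + 1)^-1 *: y).
  rewrite /= WZ gtr0_norm ?invr_gt0 // ltr_pdivrMl // mulr1; lra.
rewrite -qT => -[x _ xy].
have -> : y = T ((NW y + 1) *: x).
  by rewrite linearZ /= xy scalerA mulfV ?scale1r // gt_eqF.
exact: memv_img (memvf _).
Qed.

(** If T maps the open ball onto the open ball, then the image of the closed ball is
    a body that contains the open ball; being closed it contains the closed ball.
    Conversely, a vector of norm below 1 is k times a vector of the closed ball
    for some k < 1. *)
Lemma quotient_operatorP (V W : banach R) (T : 'Hom(V, W)) :
  quotient_operator (@bnorm _ V) (@bnorm _ W) T <->
  T @` [set x | bnorm x <= 1] = [set y | bnorm y <= 1].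
Proof.
have nV := bnormP V; have nW := bnormP W; have [_ VZ _] := nV; have [_ WZ _] := nW.
split=> [qT|cT].
  have T_surj := quotient_operator_limg nW qT.
  pose P := image_body (ball_body (std_dot V)) (F := Euclidean (std_dot W)) T_surj.
  have open_P y : bnorm y < 1 -> body_set P y.
    move=> y1; have : [set y | bnorm y < 1] y by [].
    by rewrite -qT => -[x /= /ltW x1 <-]; exists x.
  apply/seteqP; split=> [_ [x /= x1 <-]|y /= y1].
    apply/ler_addgt0Pr => e e0; have e1 : 0 < 1 + e by lra.
    have : [set y | bnorm y < 1] (T ((1 + e)^-1 *: x)).
      rewrite -qT; eexists; last reflexivity.
      by rewrite /= VZ gtr0_norm ?invr_gt0 // ltr_pdivrMl // mulr1; lra.
    rewrite /= linearZ WZ gtr0_norm ?invr_gt0 // ltr_pdivrMl // mulr1; exact: ltW.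
  suff : body_set P y by [].
  apply/gauge_le1/ler_addgt0Pr => e e0; have e1 : 0 < 1 + e by lra.
  apply/gauge_le => //; apply: open_P.
  by rewrite WZ gtr0_norm ?invr_gt0 // ltr_pdivrMl // mulr1; lra.
have scale (X : banach R) (x : X) k : 0 < k -> bnorm (k^-1 *: x) <= 1 <-> bnorm x <= k.
  move=> k0; have [_ -> _] := bnormP X.
  by rewrite gtr0_norm ?invr_gt0 // ler_pdivrMl // mulr1.
apply/seteqP; split=> [_ [x /= x1 <-]|y /= y1].
  (* [k] lies strictly between the norm and 1. *)
  pose k := (bnorm x + 1) / 2.
  have x0 : 0 <= bnorm x := is_norm_ge0 x nV.
  have k0 : 0 < k by rewrite /k; lra.
  apply: (@le_lt_trans _ _ k); last by rewrite /k; lra.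
  apply/scale => //; have : [set y | bnorm y <= 1] (T (k^-1 *: x)).
    by rewrite -cT; exists (k^-1 *: x) => //; apply/scale => //; rewrite /k; lra.
  by rewrite linearZ.
pose k := (bnorm y + 1) / 2.
have y0 : 0 <= bnorm y := is_norm_ge0 y nW.
have k0 : 0 < k by rewrite /k; lra.
have : [set y | bnorm y <= 1] (k^-1 *: y) by apply/scale => //; rewrite /k; lra.
rewrite -cT => -[x /= x1 xy]; exists (k *: x).
  rewrite /= VZ gtr0_norm //; apply: (@le_lt_trans _ _ k); last by rewrite /k; lra.
  exact: ler_piMr (ltW k0) x1.
by rewrite linearZ /= xy scalerA mulfV ?scale1r // gt_eqF.
Qed.

(** The images T_i P_i are the unit balls of the target norms exactly when the T_i
    are quotient operators, and likewise for the tensor product of the maps. *)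
Lemma projective_body_norm a :
  projective_product a <-> projective_norm (norm_of_product hl a).
Proof.
split=> [pa M N S qS|pa E F P T T_surj].
  apply/(@quotient_operatorP (Banach (body_norm_is_norm a M)) (Banach (body_norm_is_norm a N))).
  pose s i := std_dot (M i); pose r i := std_dot (N i).
  have S_surj i := quotient_operator_limg (bnormP (N i)) (qS i).
  have := pa (fun i => Euclidean (s i)) (fun i => Euclidean (r i))
    (fun i => ball_body (s i)) S S_surj.
  have -> : body_set (a (fun i => Euclidean (r i)) (fun i =>
      image_body (F := Euclidean (r i)) (ball_body (s i)) (S_surj i))) =
      body_set (a (fun i => Euclidean (r i)) (fun i => ball_body (r i))).
    apply: (@btprod_change_dot _ _ a (fun i => Euclidean (r i)) r) => i.
    by apply/quotient_operatorP.
  have ballE (X : 'I_l -> banach R) (t : forall i, {dot X i for idfun}) :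
      [set x | body_norm a (M := X) x <= 1] =
      body_set (a (fun i => Euclidean (t i)) (fun i => ball_body (t i))).
    by apply/seteqP; split=> x /(body_norm_le1 a t).
  by rewrite /= (ballE M s) (ballE N r).
pose M i := gauge_banach (P i).
pose N i := gauge_banach (image_body (P i) (T_surj i)).
have ballE (X : 'I_l -> euclidean R) (Q : forall i, sym_body (X i)) :
    [set x | body_norm a (M := fun i => gauge_banach (Q i)) x <= 1] = body_set (a X Q).
  by apply/seteqP; split=> x /(body_norm_gauge a Q).
rewrite -!ballE.
apply/(@quotient_operatorP (Banach (body_norm_is_norm a M)) (Banach (body_norm_is_norm a N))).
apply: (pa M N T) => i.
have gE (X : euclidean R) (Q : sym_body X) : [set x | gauge Q x <= 1] = body_set Q.
  by apply/seteqP; split=> x /gauge_le1.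
apply/(@quotient_operatorP (M i) (N i)); rewrite /= gE.
exact: esym (gE _ (image_body (P i) (T_surj i))).
Qed.
End Projectivity.

(** * The correspondence *)

Theorem theorem3p8 (R : realType) (l : nat) (hl : (0 < l)%N) :
  exists Psi : body_tensor_product R l -> tensor_norm R l,
    [/\ forall (a : body_tensor_product R l) (M : 'I_l -> banach R)
          (s : forall i, {dot (M i) for idfun}) (z : tensor M),
          Psi a M z =
          gauge (a (fun i => Euclidean (s i)) (fun i => ball_body (s i))) z,
        bijective Psi,
        forall a b, is_dual_product a b <-> is_dual_norm (Psi a) (Psi b),
        forall a, injective_product a <-> injective_norm (Psi a) &
        forall a, projective_product a <-> projective_norm (Psi a)].
Proof.
exists (norm_of_product hl); split.
- by move=> a M s z; exact: body_normE.
- exact: Bijective (norm_of_productK hl) (product_of_normK hl).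
- exact: is_dual_body_norm.
- exact: injective_body_norm.
- exact: projective_body_norm.
Qed.
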